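(* Let $G$ be a locally compact Abelian group and let $\widehat I$ be an ideal in the Fourier algebra $\mathcal A(G)$, corresponding to the ideal $I$ in $\mathcal M_c(G)$. Then $\mathrm{Ann}\,I$ is synthesizable if and only if $\widehat I$ is localizable.
   Context: $\mathcal C(G)$ is the space of all continuous functions $G\to\mathbb C$ with the topology of uniform convergence on compact sets. $\mathcal M_c(G)$ is the space of compactly supported complex Borel measures on $G$, identified with the dual of $\mathcal C(G)$, with the weak*-topology; it is a commutative unital algebra under convolution, $\langle \mu*\nu,f\rangle=\int\int f(x+y)\,d\mu(x)\,d\nu(y)$, and it acts on $\mathcal C(G)$ by $\mu*f(x)=\int f(x-y)\,d\mu(y)$. For an ideal $I$ in $\mathcal M_c(G)$, $\mathrm{Ann}\,I=\{f\in\mathcal C(G):\mu*f=0\text{ for all }\mu\in I\}$. A variety is a closed translation invariant linear subspace of $\mathcal C(G)$; $\tau(f)$ is the smallest variety containing $f\in \mathcal C(G)$. A variety $V$ is synthesizable if all finite dimensional varieties contained in $V$ together span a dense subspace of $V$. For $f:G\to\mathbb C$ write $\check f(x)=f(-x)$. An exponential is a continuous homomorphism from $G$ into the multiplicative group of nonzero complex numbers. The Fourier transform of $\mu\in\mathcal M_c(G)$ is the function $\widehat\mu(m)=\int\check m\,d\mu$ on the set of exponentials. The map $\mu\mapsto\widehat\mu$ is an algebra isomorphism of $\mathcal M_c(G)$ onto its image $\mathcal A(G)$, the Fourier algebra, with pointwise multiplication; $\mathcal A(G)$ carries the topology transported from $\mathcal M_c(G)$. For $H\subseteq\mathcal M_c(G)$,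 $\widehat H=\{\widehat\mu:\mu\in H\}$, and every subset of $\mathcal A(G)$ is written in this form. For $y\in G$ let $\Delta_y=\delta_{-y}-\delta_0$, so $(\Delta_y*f)(x)=f(x+y)-f(x)$. A generalized polynomial is a continuous $p:G\to\mathbb C$ for which there is a natural number $n$ with $\Delta_{y_1}*\cdots*\Delta_{y_{n+1}}*p=0$ for all $y_1,\dots,y_{n+1}\in G$. An additive function is a continuous homomorphism from $G$ into the additive group of $\mathbb C$. A polynomial on $G$ is a function $x\mapsto P(a_1(x),\dots,a_k(x))$ with $a_1,\dots,a_k$ additive functions and $P$ a complex polynomial in $k$ variables. A generalized differential operator is an operator $D$ on $\mathcal A(G)$ of the form $D\widehat\mu(m)=\int\check p_D\,\check m\,d\mu$, where $p_D$ is a generalized polynomial, called the generating function of $D$; it is a polynomial differential operator if $p_D$ is a polynomial. A generalized differential operator $D_0$ annihilates a set $H\subseteq\mathcal A(G)$ at the exponential $m$ if $D\widehat\mu(m)=0$ for all $\widehat\mu\in H$ and for every generalized differential operator $D$ with $p_D\in\tau(p_{D_0})$. For an ideal $\widehat I$ in $\mathcal A(G)$, $\mathcal P_{\widehat I,m}$ is the set of all polynomial differential operators annihilating $\widehat I$ at $m$. The ideal $\widehat I$ is localizable if every $\widehat\nu\in\mathcal A(G)$ satisfying $D\widehat\nu(m)=0$ for each exponential $m$ and every $D\in\mathcal P_{\widehat I,m}$ belongs to $\widehat I$.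
   Formalization: The ideal is assumed closed (weak*-closed in M_c(G)); for non-closed ideals the claim fails, e.g. G = ℝ and I the compactly supported absolutely continuous measures, where Ann I = {0} is synthesizable but the ideal is not localizable. *)

(* Defs.v *)
From HB Require Import structures.
From mathcomp Require Import all_boot all_order all_algebra.
From mathcomp Require Import complex.
From mathcomp Require Import boolp classical_sets functions reals topology normedtype.
From mathcomp Require mpoly.
Set Implicit Arguments.
Unset Strict Implicit.
Unset Printing Implicit Defensive.
Import Order.TTheory GRing.Theory Num.Theory.
Import numFieldNormedType.Exports.
Local Open Scope classical_set_scope.
Local Open Scope ring_scope.

(* Packing R[i] as a numClosedFieldType gives it the topology of its norm. *)
Definition cplx (R : realType) : numClosedFieldType := R[i].

Definition cfun (R : realType) (G : topologicalType) : Type :=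
  continuousType G (cplx R).

Section cfun_space.
Context {R : realType} {G : topologicalType}.
Local Notation C := (cplx R).
Local Notation E := (cfun R G).

Definition mkcfun (f : G -> C) (cf : continuous f) : E := mkcts cf.

Lemma cfunP (f g : E) : f =1 g -> f = g.
Proof. by move=> fg; apply/continuousEP. Qed.

Lemma cfun_continuous (f : E) : continuous f.
Proof. exact: cts_fun. Qed.

Fact cfun_zero_subproof : continuous (fun _ : G => 0 : C).
Proof. by move=> x; exact: cvg_cst. Qed.

Fact cfun_opp_subproof (f : E) : continuous (fun x => - f x).
Proof. by move=> x; apply: cvgN; exact: cfun_continuous. Qed.

Fact cfun_add_subproof (f g : E) : continuous (fun x => f x + g x).
Proof. by move=> x; apply: cvgD; exact: cfun_continuous. Qed.

Fact cfun_mul_subproof (f g : E) : continuous (fun x => f x * g x).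
Proof. by move=> x; apply: cvgM; exact: cfun_continuous. Qed.

Fact cfun_scale_subproof (c : C) (f : E) : continuous (fun x => c * f x).
Proof. by move=> x; apply: cvgM; [exact: cvg_cst|exact: cfun_continuous]. Qed.

Definition cfun_zero : E := mkcfun cfun_zero_subproof.
Definition cfun_opp (f : E) : E := mkcfun (@cfun_opp_subproof f).
Definition cfun_add (f g : E) : E := mkcfun (@cfun_add_subproof f g).
Definition cfun_mul (f g : E) : E := mkcfun (@cfun_mul_subproof f g).
Definition cfun_scale (c : C) (f : E) : E := mkcfun (@cfun_scale_subproof c f).

HB.instance Definition _ := Choice.copy E (continuousType G C).

Fact cfun_addA : associative cfun_add.
Proof. by move=> f g h; apply: cfunP => x; exact: addrA. Qed.
Fact cfun_addC : commutative cfun_add.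
Proof. by move=> f g; apply: cfunP => x; exact: addrC. Qed.
Fact cfun_add0 : left_id cfun_zero cfun_add.
Proof. by move=> f; apply: cfunP => x; exact: add0r. Qed.
Fact cfun_addN : left_inverse cfun_zero cfun_opp cfun_add.
Proof. by move=> f; apply: cfunP => x; exact: addNr. Qed.

HB.instance Definition _ := GRing.isZmodule.Build E cfun_addA cfun_addC
  cfun_add0 cfun_addN.

Fact cfun_scaleA a b (f : E) : cfun_scale a (cfun_scale b f) = cfun_scale (a * b) f.
Proof. by apply: cfunP => x; exact: mulrA. Qed.
Fact cfun_scale1 : left_id 1 cfun_scale.
Proof. by move=> f; apply: cfunP => x; exact: mul1r. Qed.
Fact cfun_scaleDr : right_distributive cfun_scale +%R.
Proof. by move=> a f g; apply: cfunP => x; exact: mulrDr. Qed.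
Fact cfun_scaleDl (f : E) : {morph cfun_scale^~ f : a b / a + b}.
Proof. by move=> a b; apply: cfunP => x; exact: mulrDl. Qed.

HB.instance Definition _ :=
  GRing.Zmodule_isLmodule.Build C E cfun_scaleA cfun_scale1
    cfun_scaleDr cfun_scaleDl.

Definition cfun_val (f : E) : {family compact, G -> C} := f.

HB.instance Definition _ := Uniform.copy E (initial_topology cfun_val).

Global Instance cfun_nbhs_filter (f : E) : ProperFilter (nbhs f) :=
  nbhs_pfilter f.

Lemma cfun0E x : (0 : E) x = 0. Proof. by []. Qed.
Lemma cfunNE (f : E) x : (- f) x = - f x. Proof. by []. Qed.
Lemma cfunDE (f g : E) x : (f + g) x = f x + g x. Proof. by []. Qed.
Lemma cfunZE c (f : E) x : (c *: f) x = c * f x. Proof. by []. Qed.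

Lemma cvg_cfunP (F : set_system E) (f : E) : Filter F ->
  F --> f <-> forall (K : set G) (e : C), compact K -> 0 < e ->
    F [set g : E | forall x, K x -> `|f x - g x| < e].
Proof.
move=> FF; split=> [Ff K e cK e0|H A].
  have entB : entourage [set xy : C * C | `|xy.1 - xy.2| < e].
    by rewrite -entourage_ballE; exists e.
  have := @fam_nbhs _ _ compact K _ (cfun_val f) entB cK.
  by move=> /(@initial_continuous _ _ cfun_val f)/Ff.
rewrite /nbhs/= => -[_ [[B Bop <-] Bf BA]].
have FB : {family compact, cfun_val @ F --> cfun_val f}.
  apply/fam_cvgP => K cK P /uniform_nbhs[X [+ XP]].
  rewrite -entourage_ballE => -[e /= e0 eX].
  have := H K e cK e0; apply: filterS => g Kg.
  by apply: XP => x Kx; apply: eX; exact: Kg.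
by apply: (filterS BA); apply: FB; exact: open_nbhs_nbhs.
Qed.

Lemma curry_cfun_continuous (T : topologicalType) (phi : T * G -> C)
    (cphi : forall x, continuous (fun y => phi (x, y))) :
  continuous phi -> continuous (fun x => mkcfun (cphi x) : E).
Proof.
move=> /continuous_curry[ccurry _] x; apply/cvg_cfunP => K e cK e0.
have cx : continuous (curry phi x) := cphi x.
have entB : entourage [set xy : C * C | `|xy.1 - xy.2| < e].
  by rewrite -entourage_ballE; exists e.
have := ccurry x.
move=> /(@compact_open_fam_compactP G C (curry phi x) (curry phi @ x) cx _).1.
exact: (fun h => h _ (@fam_nbhs _ _ compact K _ (curry phi x) entB cK)).
Qed.

End cfun_space.

(* M_c(G), identified with the dual of C(G): a compactly supported (regular)
   complex Borel measure mu is the continuous linear functional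
   f |-> \int f dmu. *)
Record cmeasure (R : realType) (G : topologicalType) := CMeasure {
  cint :> cfun R G -> cplx R;
  _ : scalar cint;
  _ : continuous cint }.

Section cmeasure_space.
Context {R : realType} {G : topologicalType}.
Local Notation C := (cplx R).
Local Notation E := (cfun R G).
Local Notation M := (cmeasure R G).

Lemma cint_scalar (mu : M) : scalar mu.
Proof. by case: mu. Qed.
Lemma cint_continuous (mu : M) : continuous mu.
Proof. by case: mu. Qed.

HB.instance Definition _ (mu : M) :=
  GRing.isLinear.Build C E C *%R (cint mu) (@cint_scalar mu).

Lemma cmeasureP (mu nu : M) : mu =1 nu -> mu = nu.
Proof.
case: mu nu => [f lf cf] [g lg cg] /= /funext fg; subst g.
by rewrite (Prop_irrelevance lf lg) (Prop_irrelevance cf cg).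
Qed.

HB.instance Definition _ := gen_eqMixin M.
HB.instance Definition _ := gen_choiceMixin M.

Fact cmeasure_zero_scalar : scalar (fun _ : E => 0 : C).
Proof. by move=> a f g; rewrite mulr0 addr0. Qed.
Fact cmeasure_zero_continuous : continuous (fun _ : E => 0 : C).
Proof. exact: (@cst_continuous E C 0). Qed.
Definition cmeasure_zero : M :=
  CMeasure cmeasure_zero_scalar cmeasure_zero_continuous.

Fact cmeasure_opp_scalar (mu : M) : scalar (fun f => - mu f).
Proof. by move=> a f g; rewrite linearP opprD mulrN. Qed.
Fact cmeasure_opp_continuous (mu : M) : continuous (fun f => - mu f).
Proof. by move=> f; apply: cvgN; exact: cint_continuous. Qed.
Definition cmeasure_opp (mu : M) : M :=
  CMeasure (@cmeasure_opp_scalar mu) (@cmeasure_opp_continuous mu).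

Fact cmeasure_add_scalar (mu nu : M) : scalar (fun f => mu f + nu f).
Proof. by move=> a f g; rewrite !linearP mulrDr addrACA. Qed.
Fact cmeasure_add_continuous (mu nu : M) : continuous (fun f => mu f + nu f).
Proof. by move=> f; apply: cvgD; exact: cint_continuous. Qed.
Definition cmeasure_add (mu nu : M) : M :=
  CMeasure (@cmeasure_add_scalar mu nu) (@cmeasure_add_continuous mu nu).

Fact cmeasure_addA : associative cmeasure_add.
Proof. by move=> mu nu la; apply: cmeasureP => f; exact: addrA. Qed.
Fact cmeasure_addC : commutative cmeasure_add.
Proof. by move=> mu nu; apply: cmeasureP => f; exact: addrC. Qed.
Fact cmeasure_add0 : left_id cmeasure_zero cmeasure_add.
Proof. by move=> mu; apply: cmeasureP => f; exact: add0r. Qed.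
Fact cmeasure_addN : left_inverse cmeasure_zero cmeasure_opp cmeasure_add.
Proof. by move=> mu; apply: cmeasureP => f; exact: addNr. Qed.

HB.instance Definition _ := GRing.isZmodule.Build M cmeasure_addA cmeasure_addC
  cmeasure_add0 cmeasure_addN.

Definition cmeasure_val (mu : M) : {ptws E -> C} := mu.

(* the weak* topology *)
HB.instance Definition _ := Topological.copy M (initial_topology cmeasure_val).

Fact dirac_scalar (x : G) : scalar (fun f : E => f x).
Proof. by []. Qed.

Fact dirac_continuous (x : G) : continuous (fun f : E => f x).
Proof.
move=> f A [e /= e0 eA].
have := (@cvg_cfunP _ _ (nbhs f) f (nbhs_filter f)).1 (fun A => id)
  [set x] e (@compact_set1 _ x) e0.
by apply: filterS => g /(_ x erefl) gf; exact: eA.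
Qed.

Definition dirac (x : G) : M := CMeasure (@dirac_scalar x) (@dirac_continuous x).

Lemma cmeasure_addE (mu nu : M) f : (mu + nu) f = mu f + nu f.
Proof. by []. Qed.
Lemma cmeasure_oppE (mu : M) f : (- mu) f = - mu f.
Proof. by []. Qed.

End cmeasure_space.

Section convolution_algebra.
Context {R : realType} {G : topologicalZmodType}.
Local Notation C := (cplx R).
Local Notation E := (cfun R G).
Local Notation M := (cmeasure R G).

Fact cfun_check_continuous (f : E) : continuous (fun x => f (- x)).
Proof.
move=> x; apply: (continuous_comp (f := fun x => - x)).
  exact: opp_continuous.
exact: cfun_continuous.
Qed.

Definition cfun_check (f : E) : E := mkcfun (@cfun_check_continuous f).

Fact addf_continuous (f : E) : continuous (fun xy : G * G => f (xy.1 + xy.2)).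
Proof.
move=> x; apply: (continuous_comp (f := fun xy : G * G => xy.1 + xy.2)).
  exact: add_continuous.
exact: cfun_continuous.
Qed.

Fact subf_continuous (f : E) : continuous (fun xy : G * G => f (xy.1 - xy.2)).
Proof.
move=> x; apply: (continuous_comp (f := fun xy : G * G => xy.1 - xy.2)).
  exact: sub_continuous.
exact: cfun_continuous.
Qed.

Fact slice_continuous (phi : G * G -> C) (x : G) :
  continuous phi -> continuous (fun y => phi (x, y)).
Proof. by move=> /continuous_curry[_]; apply. Qed.

(* y |-> f (x + y) *)
Definition cfun_translate (x : G) (f : E) : E :=
  mkcfun (@slice_continuous _ x (@addf_continuous f)).

(* y |-> f (x - y) *)
Definition cfun_reflect_translate (x : G) (f : E) : E :=
  mkcfun (@slice_continuous _ x (@subf_continuous f)).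

Fact act_continuous (mu : M) (f : E) :
  continuous (fun x => mu (cfun_reflect_translate x f)).
Proof.
move=> x; apply: (continuous_comp (f := fun x => cfun_reflect_translate x f)).
  exact: curry_cfun_continuous (@subf_continuous f) _.
exact: cint_continuous.
Qed.

Definition act (mu : M) (f : E) : E := mkcfun (@act_continuous mu f).

Fact partial_integral_continuous (nu : M) (f : E) :
  continuous (fun x => nu (cfun_translate x f)).
Proof.
move=> x; apply: (continuous_comp (f := fun x => cfun_translate x f)).
  exact: curry_cfun_continuous (@addf_continuous f) _.
exact: cint_continuous.
Qed.

(* x |-> \int f (x + y) dnu(y) *)
Definition partial_integral (nu : M) (f : E) : E :=
  mkcfun (@partial_integral_continuous nu f).

Fact partial_integral_linear (nu : M) : linear (partial_integral nu).
Proof.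
move=> a f g; apply: cfunP => x.
rewrite cfunDE cfunZE /= -linearP; congr (nu _).
by apply: cfunP.
Qed.

Fact partial_integral_cvg (nu : M) : continuous (partial_integral nu).
Proof.
move=> f; apply/cvg_cfunP => K e cK e0.
pose V (A : set E) : set E :=
  [set h | exists x g, [/\ K x, A g & h = cfun_translate x (f - g)]].
pose F := filter_from (nbhs f) V.
have FF : Filter F.
  apply: filter_from_filter; first by exists setT; exact: filterT.
  move=> A B fA fB; exists (A `&` B); first exact: filterI.
  by move=> _ [x [g [Kx [Ag Bg] ->]]]; split; exists x, g.
have F0 : F --> (0 : E).
  apply/cvg_cfunP => L d cL d0.
  have cKL : compact [set xy.1 + xy.2 | xy in K `*` L].
    apply: continuous_compact; last exact: compact_setX.
    exact/continuous_subspaceT/add_continuous.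
  exists [set g : E | forall z, [set xy.1 + xy.2 | xy in K `*` L] z ->
    `|f z - g z| < d]; first exact: (@cvg_cfunP _ _ (nbhs f) f (nbhs_filter f)).1.
  move=> _ [x [g [Kx Ag ->]]] y Ly; rewrite cfun0E sub0r normrN.
  by apply: Ag; exists (x, y).
have [A fA] : F [set h | `|nu h| < e].
  apply: F0; apply: (@cint_continuous _ _ nu 0 [set z | `|z| < e]).
  by rewrite linear0; exists e => //= z; rewrite /= sub0r normrN.
move=> VA; apply: filterS fA => g Ag x Kx.
have -> : partial_integral nu f x - partial_integral nu g x =
  nu (cfun_translate x (f - g)).
  by rewrite /= -linearB; congr (nu _); exact: cfunP.
by apply: VA; exists x, g.
Qed.

Fact conv_scalar (mu nu : M) : scalar (fun f => mu (partial_integral nu f)).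
Proof. by move=> a f g; rewrite partial_integral_linear linearP. Qed.

Fact conv_continuous (mu nu : M) :
  continuous (fun f => mu (partial_integral nu f)).
Proof.
move=> f; apply: (continuous_comp (f := partial_integral nu)).
  exact: partial_integral_cvg.
exact: cint_continuous.
Qed.

Definition convolution (mu nu : M) : M :=
  CMeasure (@conv_scalar mu nu) (@conv_continuous mu nu).

(* Closure under scalars follows, as c mu = (c delta_0) * mu. *)
Definition is_ideal (I : set M) : Prop :=
  [/\ I 0, forall mu nu, I mu -> I nu -> I (mu + nu) &
      forall mu nu, I mu -> I (convolution nu mu) /\ I (convolution mu nu)].

Definition Ann (I : set M) : set E :=
  [set f | forall mu, I mu -> act mu f = 0].

Definition is_subspace (V : set E) : Prop :=
  V 0 /\ forall a f g, V f -> V g -> V (a *: f + g).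

Definition is_variety (V : set E) : Prop :=
  [/\ is_subspace V, closed V & forall x f, V f -> V (cfun_translate x f)].

Definition variety_of (f : E) : set E := smallest is_variety [set f].

Definition finite_dimensional (V : set E) : Prop :=
  exists n (e : 'I_n -> E), forall f, V f ->
    exists c : 'I_n -> C, f = \sum_(i < n) c i *: e i.

Definition lin_span (A : set E) : set E := smallest is_subspace A.

Definition synthesizable (V : set E) : Prop :=
  V `<=` closure (lin_span (\bigcup_(W in
    [set W | [/\ is_variety W, finite_dimensional W & W `<=` V]]) W)).

Definition difference_measure (y : G) : M := dirac (- y) - dirac 0.

Lemma act_difference_measure (y : G) (f : E) (x : G) :
  act (difference_measure y) f x = f (x + y) - f x.
Proof. by rewrite -[LHS]/(f (x - - y) - f (x - 0)) opprK subr0. Qed.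

(* The products Delta_{y_1} * ... * Delta_{y_(n+1)} * p are iterated from the
   right, over all sequences of n + 1 elements of G. *)
Definition generalized_polynomial (p : E) : Prop :=
  exists n : nat, forall y : n.+1.-tuple G,
    foldr (fun z g => act (difference_measure z) g) p y = 0.

Definition additive_function (a : E) : Prop := {morph a : x y / x + y}.

Definition polynomial_function (p : E) : Prop :=
  exists k (a : 'I_k -> E) (P : mpoly.mpoly k C),
    (forall i, additive_function (a i)) /\
    forall x, p x = mpoly.meval (fun i => a i x) P.

End convolution_algebra.

Record exponential (R : realType) (G : topologicalZmodType) := Exponential {
  exponential_fun :> cfun R G;
  exponential_neq0 : forall x, exponential_fun x != 0;
  exponentialD : {morph exponential_fun : x y / x + y >-> x * y} }.

(* The Fourier algebra A(G). Fourier mu is the transform mu^, a function on the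
   exponentials through the coercion fourier_eval. As mu |-> mu^ is an algebra
   isomorphism, an element of A(G) determines its measure; keeping that measure
   in the element makes the operators mu^ |-> D mu^ well defined. *)
Record fourier_algebra (R : realType) (G : topologicalZmodType) :=
  Fourier { fourier_measure : cmeasure R G }.
Arguments Fourier {R G}.

Definition fourier_eval (R : realType) (G : topologicalZmodType)
    (u : fourier_algebra R G) (m : exponential R G) : cplx R :=
  fourier_measure u (cfun_check m).
Coercion fourier_eval : fourier_algebra >-> Funclass.

Record diff_operator (R : realType) (G : topologicalZmodType) := DiffOperator {
  generating_function : cfun R G;
  _ : generalized_polynomial generating_function }.

Definition diff_operator_apply (R : realType) (G : topologicalZmodType)
    (D : diff_operator R G) (u : fourier_algebra R G) (m : exponential R G) :
    cplx R :=
  fourier_measure u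
    (cfun_mul (cfun_check (generating_function D)) (cfun_check m)).
Coercion diff_operator_apply : diff_operator >-> Funclass.

Section localization.
Context {R : realType} {G : topologicalZmodType}.
Local Notation A := (fourier_algebra R G).
Local Notation M := (cmeasure R G).

Lemma fourier_conv (mu nu : M) (m : exponential R G) :
  Fourier (convolution mu nu) m = Fourier mu m * Fourier nu m.
Proof.
rewrite /fourier_eval /=.
have tE x : cfun_translate x (cfun_check m) = cfun_check m x *: cfun_check m.
  apply: cfunP => y; rewrite cfunZE.
  by have := exponentialD m (- x) (- y); rewrite -opprD.
suff -> : partial_integral nu (cfun_check m) = nu (cfun_check m) *: cfun_check m.
  by rewrite linearZ mulrC.
by apply: cfunP => x; rewrite cfunZE mulrC -linearZ -tE.
Qed.

Definition polynomial_operator (D : diff_operator R G) : Prop :=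
  polynomial_function (generating_function D).

Definition annihilates (D0 : diff_operator R G) (H : set A)
    (m : exponential R G) : Prop :=
  forall D : diff_operator R G,
    variety_of (generating_function D0) (generating_function D) ->
    forall u, H u -> D u m = 0.

Definition annihilating_operators (H : set A) (m : exponential R G) :
    set (diff_operator R G) :=
  [set D | polynomial_operator D /\ annihilates D H m].

Definition localizable (H : set A) : Prop :=
  forall u : A,
    (forall m D, annihilating_operators H m D -> D u m = 0) -> H u.

End localization.

(* Main.v *)
(* By duality the theorem becomes a statement about exponential monomials [p m],
   with [p] a polynomial and [m] an exponential. A polynomial operator with
   generating function [p] annihilates the transform of [I] at [m] iff [p m] lies
   in [Ann I], and a measure kills the reflections of all functions of [Ann I] iff
   it lies in [I], since [I] is weak*-closed. So [I] is localizable iff every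
   measure vanishing on the monomials of [Ann I] vanishes on [Ann I], that is, by
   Hahn-Banach, iff these monomials span a dense subspace of [Ann I]. It remains
   to see that they have the same span as the finite dimensional varieties in
   [Ann I]. The orbit of [p m] under translations has finite dimension. Conversely
   translations act on a finite dimensional variety by commuting matrices; on a
   joint generalized eigenspace they are an exponential times a unipotent
   representation, whose logarithm is additive. *)
Require Import Defs.
From HB Require Import structures.
From mathcomp Require Import all_boot all_order all_algebra.
From mathcomp Require Import complex.
From mathcomp Require Import boolp classical_sets functions reals topology normedtype.
From mathcomp Require mpoly.
From mathcomp Require Import ring lra.
Set Implicit Arguments.
Unset Strict Implicit.
Unset Printing Implicit Defensive.
Import Order.TTheory GRing.Theory Num.Theory.
Import numFieldNormedType.Exports.
Local Open Scope classical_set_scope.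
Local Open Scope ring_scope.

(** * Sublinear functionals and the Hahn-Banach theorem *)


Section hahn_banach.
Variables (R : realType) (V : lmodType R).
Implicit Types (p q : V -> R) (x y : V).

Definition sublinear p :=
  (forall x y, p (x + y) <= p x + p y) /\
  (forall t x, 0 < t -> p (t *: x) <= t * p x).

Lemma le_infD (A B : set R) z : A !=set0 -> B !=set0 ->
  (forall a b, A a -> B b -> z <= a + b) -> z <= inf A + inf B.
Proof.
move=> A0 B0 H; rewrite -lerBlDr; apply: lb_le_inf => // a Aa.
rewrite lerBlDr -lerBlDl; apply: lb_le_inf => // b Bb.
by rewrite lerBlDl; exact: H.
Qed.

Lemma le_infM (A : set R) t z : A !=set0 -> 0 < t ->
  (forall a, A a -> z <= t * a) -> z <= t * inf A.
Proof.
move=> A0 t0 H; rewrite -ler_pdivrMl //; apply: lb_le_inf => // a Aa.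
by rewrite ler_pdivrMl //; exact: H.
Qed.

Lemma sublinear0 p : sublinear p -> p 0 = 0.
Proof.
move=> [pD pZ]; have := pD 0 0; have := pZ 2^-1 0; rewrite scaler0 addr0.
have h : 0 < 2^-1 :> R by rewrite invr_gt0.
by move=> /(_ h) h1 h2; lra.
Qed.

Lemma sublinearN p x : sublinear p -> - p (- x) <= p x.
Proof.
by move=> sp; have := sp.1 x (- x); rewrite subrr sublinear0 //; lra.
Qed.

Lemma sublinearZ p t x : sublinear p -> 0 <= t -> p (t *: x) = t * p x.
Proof.
move=> sp; rewrite le_eqVlt => /predU1P[<-|t0].
  by rewrite scale0r mul0r sublinear0.
apply/eqP; rewrite eq_le sp.2 //= -ler_pdivlMl //.
have := sp.2 t^-1 (t *: x); rewrite invr_gt0 scalerA mulVf ?gt_eqF // scale1r.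
exact.
Qed.

(* [tighten p y] is a sublinear functional below [p], equal to [p] only if
   [p (x + y) = p x + p y] for all [x]: minimal sublinear functionals are linear. *)
Definition tighten_set p y x := [set p (x + t *: y) - t * p y | t in [set t | 0 <= t]].
Definition tighten p y x := inf (tighten_set p y x).

Lemma tighten_set_nonempty p y x : tighten_set p y x !=set0.
Proof. by exists (p (x + 0 *: y) - 0 * p y); exists 0 => //=. Qed.

Lemma tighten_set_lbound p y x : sublinear p ->
  lbound (tighten_set p y x) (- p (- x)).
Proof.
move=> sp _ [t /= t0 <-].
have := sp.1 (x + t *: y) (- x); rewrite addrC addKr sublinearZ //; lra.
Qed.

Lemma tighten_le p y x t : sublinear p -> 0 <= t ->
  tighten p y x <= p (x + t *: y) - t * p y.
Proof.
move=> sp t0; apply: ge_inf; last by exists t.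
by exists (- p (- x)); exact: tighten_set_lbound.
Qed.

Lemma tighten_sublinear p y : sublinear p -> sublinear (tighten p y).
Proof.
move=> sp; split=> [x z|t x t0].
  apply: le_infD; [exact: tighten_set_nonempty..|].
  move=> _ _ [s /= s0 <-] [t /= t0 <-].
  apply: (le_trans (tighten_le _ _ sp (addr_ge0 s0 t0))).
  have := sp.1 (x + s *: y) (z + t *: y).
  by rewrite addrACA -scalerDl mulrDl; lra.
apply: le_infM => //; first exact: tighten_set_nonempty.
move=> _ [s /= s0 <-].
apply: (le_trans (tighten_le _ _ sp (mulr_ge0 (ltW t0) s0))).
by rewrite -scalerA -scalerDr sublinearZ ?(ltW t0) // -mulrA -mulrBr.
Qed.

Lemma exists_minimal_sublinear p : sublinear p ->
  exists q, [/\ sublinear q, forall x, q x <= p x &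
    forall r, sublinear r -> (forall x, r x <= q x) -> r = q].
Proof.
move=> sp.
pose T := {q : V -> R | sublinear q /\ forall x, q x <= p x}.
pose below (q r : T) := `[< forall x, sval r x <= sval q x >].
have [||||[q [sq qp]] qmin] := @Zorn T below.
- by move=> q; apply/asboolP.
- move=> q r s /asboolP qr /asboolP rs; apply/asboolP => x.
  exact: le_trans (rs x) (qr x).
- move=> [q hq] [r hr] /asboolP /= rq /asboolP /= qr.
  have e : q = r by apply/funext => x; apply/eqP; rewrite eq_le rq qr.
  by subst r; rewrite (Prop_irrelevance hq hr).
- move=> F Ftot; have [F0|/nonemptyPn F0] := pselect (F !=set0); last first.
    by exists (exist _ p (conj sp (fun x => lexx _))) => s; rewrite F0.
  pose S x := [set sval q x | q in F].
  have S0 x : S x !=set0 by case: F0 => q Fq; exists (sval q x), q.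
  have Slb x : has_lbound (S x).
    exists (- p (- x)) => _ [[q [sq qp]] Fq <-] /=.
    by apply: le_trans (sublinearN x sq); rewrite lerN2.
  have Sle (q : T) x : F q -> inf (S x) <= sval q x.
    by move=> Fq; apply: ge_inf => //; exists q.
  have si : sublinear (fun x => inf (S x)).
    split=> [x y|t x t0].
      apply: le_infD => // _ _ [q Fq <-] [r Fr <-].
      have [/asboolP qr|/asboolP rq] := Ftot _ _ Fq Fr.
        apply: le_trans (Sle r _ Fr) _.
        by apply: le_trans ((svalP r).1.1 _ _) _; rewrite lerD2r.
      apply: le_trans (Sle q _ Fq) _.
      by apply: le_trans ((svalP q).1.1 _ _) _; rewrite lerD2l.
    apply: le_infM => // _ [q Fq <-].
    by apply: le_trans (Sle q _ Fq) _; exact: (svalP q).1.2.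
  have ip x : inf (S x) <= p x.
    case: F0 => q Fq; apply: le_trans (Sle q x Fq) _; exact: (svalP q).2.
  by exists (exist (fun q => sublinear q /\ forall x, q x <= p x) _ (conj si ip))
    => s Fs; apply/asboolP => x; exact: Sle.
- exists q; split=> // r sr rq.
  have rp x : r x <= p x by apply: le_trans (rq x) (qp x).
  suff /(congr1 sval) : exist _ r (conj sr rp) = exist _ q (conj sq qp) :> T by [].
  by apply: qmin; apply/asboolP.
Qed.

Lemma minimal_sublinear_scalar q : sublinear q ->
  (forall r, sublinear r -> (forall x, r x <= q x) -> r = q) -> scalar q.
Proof.
move=> sq qmin.
have qD x y : q (x + y) = q x + q y.
  apply/eqP; rewrite eq_le sq.1 /=.
  have e : tighten q y = q.
    apply: qmin; first exact: tighten_sublinear.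
    by move=> z; have := tighten_le y z sq (lexx 0); rewrite scale0r addr0 mul0r subr0.
  by have := tighten_le y x sq ler01; rewrite e scale1r mul1r lerBrDr.
have qN x : q (- x) = - q x.
  by apply/eqP; rewrite -addr_eq0 -qD addNr sublinear0.
move=> a x y; rewrite qD; congr (_ + _).
have [a0|a0] := leP 0 a; first exact: sublinearZ.
rewrite -[a]opprK scaleNr qN sublinearZ ?oppr_ge0 ?(ltW a0) //.
by rewrite !mulNr.
Qed.

Theorem hahn_banach p f : sublinear p ->
  exists u : V -> R, [/\ scalar u, forall x, u x <= p x & p f <= u f].
Proof.
move=> sp; have [u [su up umin]] := exists_minimal_sublinear (tighten_sublinear f sp).
exists u; split; first exact: minimal_sublinear_scalar.
  move=> x; apply: le_trans (up x) _.
  by have := tighten_le f x sp (lexx 0); rewrite scale0r addr0 mul0r subr0.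
have := up (- f); have := tighten_le f (- f) sp ler01.
rewrite scale1r addNr sublinear0 // mul1r.
by have := sublinearN f su; lra.
Qed.

End hahn_banach.

(** * Separation in the space of continuous functions *)


Definition realified (R : realType) (V : lmodType (cplx R)) : Type := V.

Section realified.
Variables (R : realType) (V : lmodType (cplx R)).

HB.instance Definition _ := GRing.Zmodule.on (realified V).

Definition realified_scale (t : R) (x : realified V) : realified V :=
  (t%:C%C : cplx R) *: (x : V).

Fact realified_scaleA a b x :
  realified_scale a (realified_scale b x) = realified_scale (a * b) x.
Proof. by rewrite /realified_scale scalerA rmorphM. Qed.
Fact realified_scale1 : left_id 1 realified_scale.
Proof. by move=> x; rewrite /realified_scale rmorph1 scale1r. Qed.
Fact realified_scaleDr : right_distributive realified_scale +%R.
Proof. by move=> a x y; exact: scalerDr. Qed.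
Fact realified_scaleDl x : {morph realified_scale^~ x : a b / a + b}.
Proof. by move=> a b; rewrite /realified_scale rmorphD scalerDl. Qed.

HB.instance Definition _ := GRing.Zmodule_isLmodule.Build R (realified V)
  realified_scaleA realified_scale1 realified_scaleDr realified_scaleDl.

End realified.

Lemma cplx_norm_real (R : realType) (z : cplx R) : exists2 r : R, 0 <= r & `|z| = (r%:C)%C.
Proof.
exists (Num.sqrt ((complex.Re z)^+2 + (complex.Im z)^+2)); first exact: sqrtr_ge0.
exact: normc_def.
Qed.

Section cfun_topology.
Context {R : realType} {G : topologicalType}.
Local Notation C := (cplx R).
Local Notation E := (cfun R G).
Local Notation M := (cmeasure R G).

Lemma cfun_bounded (f : E) (K : set G) : compact K ->
  exists2 r : R, 0 < r & forall x, K x -> `|f x| < (r%:C)%C.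
Proof.
move=> /compact_near_coveringP cK.
have [|N _ HN] := cK nat \oo (fun n x => `|f x| < ((n%:R : R)%:C)%C) _.
  move=> x Kx; have [r r0 fr] := cplx_norm_real (f x).
  exists ([set y : G | `|f x - f y| < 1], [set n : nat | (r + 1 < n%:R)%R]).
    split; first exact: (cvgrPdist_lt _ _).1 (@cfun_continuous _ _ f x) 1 ltr01.
    exact: nbhs_infty_gtr.
  move=> [y n] /= [fy rn].
  have : `|f y| < `|f x| + 1.
    by rewrite -ltrBlDl; apply: le_lt_trans fy; rewrite distrC lerB_dist.
  move=> /lt_trans; apply.
  rewrite fr -(rmorph1 (real_complex R)) -rmorphD.
  by rewrite ltcR.
exists N.+1%:R => // x Kx; apply: (HN N.+1) => //=.
Qed.

Lemma nbhs_cfunP (f : E) (A : set E) : nbhs f A ->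
  exists K (r : R), [/\ compact K, 0 < r &
    [set g : E | forall x, K x -> `|f x - g x| < (r%:C)%C] `<=` A].
Proof.
pose F := filter_from [set Kr : set G * R | compact Kr.1 /\ 0 < Kr.2]
  (fun Kr => [set g : E | forall x, Kr.1 x -> `|f x - g x| < (Kr.2%:C)%C]).
have FF : Filter F.
  apply: filter_from_filter.
    by exists (set0, 1); split => //=; exact: compact0.
  move=> [K r] [L s] /= [cK r0] [cL s0]; exists (K `|` L, Num.min r s).
    by split=> /=; [exact: compactU|rewrite lt_min r0 s0].
  move=> g /= H; split=> x Kx.
    by apply: lt_le_trans (H x (or_introl Kx)) _; rewrite lecR ge_min lexx.
  by apply: lt_le_trans (H x (or_intror Kx)) _; rewrite lecR ge_min lexx orbT.
have : F --> f.
  apply/cvg_cfunP => K e cK e0.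
  have [r r0 er] := cplx_norm_real e; rewrite gtr0_norm // in er.
  rewrite er in e0 *; exists (K, r) => //=; split => //.
  by rewrite -ltcR.
by move=> /[apply] -[[K r] /= [cK r0] KA]; exists K, r.
Qed.

Lemma closed_kernel (mu : M) : closed [set f : E | mu f = 0].
Proof.
rewrite -[X in closed X]/(mu @^-1` [set 0]).
apply: preimage_closed; first by move=> x _; exact: cint_continuous.
exact: (@accessible_closed_set1 C (hausdorff_accessible (@norm_hausdorff _ C))).
Qed.

End cfun_topology.

Section dist_seminorm.
Context {R : realType} {G : topologicalZmodType}.
Local Notation C := (cplx R).
Local Notation E := (cfun R G).
Local Notation M := (cmeasure R G).

(* For compact [K] the set is nonempty, so that [inf] is not a junk value. *)
Definition dist_seminorm (W : set E) (K : set G) (g : E) : R :=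
  inf [set r : R | 0 < r /\ exists2 w, W w & forall x, K x -> `|g x - w x| < (r%:C)%C].

Variables (W : set E) (K : set G).
Hypotheses (sW : is_subspace W) (cK : compact K).

Let S (g : E) := [set r : R | 0 < r /\ exists2 w, W w & forall x, K x -> `|g x - w x| < (r%:C)%C].

Let S_nonempty g : S g !=set0.
Proof.
have [r r0 gr] := cfun_bounded g cK.
exists r; split=> //; exists 0; first exact: sW.1.
by move=> x Kx; rewrite cfun0E subr0; exact: gr.
Qed.

Lemma dist_seminorm_le (g w : E) (r : R) : 0 < r -> W w ->
  (forall x, K x -> `|g x - w x| < (r%:C)%C) -> dist_seminorm W K g <= r.
Proof.
move=> r0 Ww gw; apply: ge_inf; last by split => //; exists w.
by exists 0 => s [/ltW].
Qed.

Lemma le_dist_seminorm (g : E) (s : R) : (forall w, W w ->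
  ~ forall x, K x -> `|g x - w x| < (s%:C)%C) -> s <= dist_seminorm W K g.
Proof.
move=> H; apply: lb_le_inf; first exact: S_nonempty.
move=> r [r0 [w Ww gw]]; rewrite leNgt; apply/negP => rs.
by apply: (H w Ww) => x Kx; apply: lt_trans (gw x Kx) _; rewrite ltcR.
Qed.

Lemma dist_seminorm_in w : W w -> dist_seminorm W K w <= 0.
Proof.
move=> Ww; apply/ler_addgt0Pr => e e0; rewrite add0r.
by apply: (@dist_seminorm_le _ w) => // x _; rewrite subrr normr0 ltcR.
Qed.

Lemma dist_seminorm_sublinear : sublinear (dist_seminorm W K : realified E -> R).
Proof.
split=> [g h|t g t0].
  apply: le_infD; [exact: S_nonempty..|].
  move=> r s [r0 [w Ww gw]] [s0 [v Wv hv]].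
  apply: (@dist_seminorm_le _ (w + v)); first exact: addr_gt0.
    by rewrite -[w]scale1r; exact: sW.2.
  move=> x Kx; rewrite !cfunDE opprD addrACA rmorphD.
  by apply: le_lt_trans (ler_normD _ _) _; apply: ltrD; [exact: gw|exact: hv].
apply: le_infM => //; first exact: S_nonempty.
move=> r [r0 [w Ww gw]].
apply: (@dist_seminorm_le _ ((t%:C)%C *: w)); first exact: mulr_gt0.
  by rewrite -[_ *: w]addr0; apply: sW.2 => //; exact: sW.1.
move=> x Kx; rewrite -[(t *: g) x]/(((t%:C)%C : C) * (g : E) x) cfunZE -mulrBr normrM rmorphM.
have tC : 0 < ((t%:C)%C : C) by rewrite ltcR.
rewrite (gtr0_norm tC) (ltr_pM2l tC).
exact: gw.
Qed.

End dist_seminorm.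



Section separation.
Context {R : realType} {G : topologicalZmodType}.
Local Notation C := (cplx R).
Local Notation E := (cfun R G).
Local Notation M := (cmeasure R G).

Definition complexify (u : realified E -> R) (g : E) : C :=
  (u g +i* - u (('i%C : C) *: g))%C.

Lemma complexify_scalar (u : realified E -> R) :
  scalar u -> scalar (complexify u).
Proof.
move=> lu a f g.
have uD x y : u (x + y) = u x + u y by have := lu 1 x y; rewrite scale1r mul1r.
have uZ (t : R) (x : E) : u ((t%:C)%C *: x) = t * u x.
  have u0 : u 0 = 0 by have := uD 0 0; rewrite addr0; lra.
  by have := lu t x 0; rewrite !addr0 u0 addr0.
have aE : a = (((complex.Re a)%:C)%C : C) + (((complex.Im a)%:C)%C : C) * ('i%C : C).
  by rewrite [LHS]complexE [X in _ + X]mulrC.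
have iE : ('i%C : C) * 'i%C = -1 by rewrite -expr2 sqr_i.
have e1 : u (a *: f) = complex.Re a * u f + complex.Im a * u (('i%C : C) *: f).
  by rewrite [in LHS]aE scalerDl uD -scalerA !uZ.
have e2 : u (('i%C : C) *: (a *: f)) =
    complex.Re a * u (('i%C : C) *: f) - complex.Im a * u f.
  rewrite scalerA [in LHS]aE mulrDr scalerDl uD mulrCA iE mulrN1 mulrC -scalerA uZ.
  rewrite -rmorphN uZ; ring.
rewrite /complexify scalerDr !uD e1 e2 /=.
case: a {aE e1 e2} => a b /=.
apply/eqP; rewrite eq_complex /=; apply/andP; split; apply/eqP; ring.
Qed.

Lemma scalar_cfun_continuous (phi : E -> C) (K : set G) : scalar phi -> compact K ->
  (forall e : C, 0 < e -> exists2 d : C, 0 < d &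
    forall g : E, (forall x, K x -> `|g x| < d) -> `|phi g| < e) ->
  continuous phi.
Proof.
move=> lphi cK H f; apply/cvgrPdist_lt => e e0.
have [d d0 Hd] := H e e0.
have := (@cvg_cfunP _ _ (nbhs f) f (nbhs_filter f)).1 (fun A => id) K d cK d0.
apply: filterS => g fg.
have -> : phi f - phi g = phi (f - g).
  by rewrite addrC -mulN1r -lphi scaleN1r addrC.
by apply: Hd => x Kx; exact: fg.
Qed.

Theorem closure_separation (W : set E) (f : E) : is_subspace W -> ~ closure W f ->
  exists mu : M, (forall w, W w -> mu w = 0) /\ mu f != 0.
Proof.
move=> sW nWf.
have [K [r [cK r0 Kr]]] : exists K (r : R), [/\ compact K, 0 < r &
    forall w, W w -> ~ forall x, K x -> `|f x - w x| < (r%:C)%C].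
  move: nWf; rewrite /closure /= => /existsNP[A /not_implyP[/nbhs_cfunP]].
  move=> [K [r [cK r0 KA]]] WA; exists K, r; split=> // w Ww fw.
  by apply: WA; exists w; split => //; exact: KA.
have [u [lu up pu]] := hahn_banach (f : realified E) (dist_seminorm_sublinear sW cK).
have uf : 0 < u f by apply: lt_le_trans r0 (le_trans _ pu); exact: le_dist_seminorm.
have uD (x y : E) : u (x + y) = u x + u y by have := lu 1 x y; rewrite scale1r mul1r.
have u0 : u 0 = 0 by have := uD 0 0; rewrite addr0; lra.
have uN (x : E) : u (- x) = - u x.
  by apply/eqP; rewrite -addr_eq0 -uD addNr u0.
have ubound (g : E) (d : R) : 0 < d -> (forall x, K x -> `|g x| < (d%:C)%C) -> `|u g| <= d.
  move=> d0 gd; rewrite ler_norml lerNl -uN; apply/andP; split.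
    apply: le_trans (up _) _; apply: (@dist_seminorm_le _ _ _ _ _ 0) => // [|x Kx].
      exact: sW.1.
    by rewrite cfunNE cfun0E subr0 normrN; exact: gd.
  apply: le_trans (up _) _; apply: (@dist_seminorm_le _ _ _ _ _ 0) => // [|x Kx].
    exact: sW.1.
  by rewrite cfun0E subr0; exact: gd.
have uW w : W w -> u w = 0.
  move=> Ww; have := up w; have := up (- w); rewrite uN.
  have WN : W (- w) by rewrite -scaleN1r -[_ *: _]addr0; apply: sW.2 => //; exact: sW.1.
  have := dist_seminorm_in K Ww; have := dist_seminorm_in K WN; lra.
have cu : continuous (complexify u).
  apply: scalar_cfun_continuous cK _; first exact: complexify_scalar.
  move=> e e0; have [d d0 ed] := cplx_norm_real e; rewrite gtr0_norm // in ed.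
  have {}d0 : 0 < d by rewrite -ltcR -ed.
  exists ((d / 3)%:C)%C => [|g gd]; first by rewrite ltcR divr_gt0.
  have h1 : `|u g| <= d / 3 by apply: ubound => //; rewrite divr_gt0.
  have h2 : `|u (('i%C : C) *: g)| <= d / 3.
    apply: ubound; first by rewrite divr_gt0.
    move=> x Kx; rewrite cfunZE normrM (_ : `|'i%C : C| = 1) ?mul1r; first exact: gd.
    by rewrite normc_def /= expr0n expr1n add0r sqrtr1.
  have -> : complexify u g =
      ((u g)%:C)%C + ('i%C : C) * (((- u (('i%C : C) *: g))%:C)%C : C) by exact: complexE.
  rewrite ed.
  apply: le_lt_trans (ler_normD _ _) _.
  rewrite normrM (_ : `|'i%C : C| = 1); last by rewrite normc_def /= expr0n expr1n add0r sqrtr1.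
  rewrite mul1r !normc_def /= expr0n /= !addr0 !sqrtr_sqr normrN -rmorphD ltcR.
  lra.
exists (CMeasure (complexify_scalar lu) cu); split=> [w Ww|] /=.
  rewrite /complexify uW // uW ?oppr0 //.
  by rewrite -[_ *: _]addr0; apply: sW.2 => //; exact: sW.1.
by rewrite /complexify eq_complex /= gt_eqF.
Qed.

End separation.

(** * Compactly supported measures and the weak* topology *)


Section cmeasure_operations.
Context {R : realType} {G : topologicalType}.
Local Notation C := (cplx R).
Local Notation E := (cfun R G).
Local Notation M := (cmeasure R G).

Fact cmeasure_scale_scalar (c : C) (mu : M) : scalar (fun f => c * mu f).
Proof. by move=> a f g; rewrite linearP mulrDr mulrCA. Qed.

Fact cmeasure_scale_continuous (c : C) (mu : M) : continuous (fun f => c * mu f).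
Proof. by move=> f; apply: cvgM; [exact: cvg_cst|exact: cint_continuous]. Qed.

Definition cmeasure_scale (c : C) (mu : M) : M :=
  CMeasure (@cmeasure_scale_scalar c mu) (@cmeasure_scale_continuous c mu).

Lemma cmeasure_scaleE c (mu : M) f : cmeasure_scale c mu f = c * mu f.
Proof. by []. Qed.

Section image.
Variables (phi : G -> G) (cphi : continuous phi).

Fact cfun_comp_continuous (f : E) : continuous (fun x => f (phi x)).
Proof. by move=> x; apply: continuous_comp; [exact: cphi|exact: cfun_continuous]. Qed.

Definition cfun_comp (f : E) : E := mkcfun (@cfun_comp_continuous f).

Lemma continuous_cfun_comp : continuous cfun_comp.
Proof.
move=> f; apply/cvg_cfunP => K e cK e0.
have cphiK : compact (phi @` K).
  by apply: continuous_compact => //; exact: continuous_subspaceT.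
have := (@cvg_cfunP _ _ (nbhs f) f (nbhs_filter f)).1 (fun A => id) _ e cphiK e0.
by apply: filterS => g fg x Kx; apply: fg; exists x.
Qed.

Fact cmeasure_image_scalar (mu : M) : scalar (fun f => mu (cfun_comp f)).
Proof. by move=> a f g; rewrite -linearP; congr (mu _); exact: cfunP. Qed.

Fact cmeasure_image_continuous (mu : M) : continuous (fun f => mu (cfun_comp f)).
Proof.
move=> f; apply: (continuous_comp (f := cfun_comp)); first exact: continuous_cfun_comp.
exact: cint_continuous.
Qed.

Definition cmeasure_image (mu : M) : M :=
  CMeasure (@cmeasure_image_scalar mu) (@cmeasure_image_continuous mu).

End image.

Lemma continuous_cfun_mulr (h : E) : continuous (fun f : E => cfun_mul f h).
Proof.
move=> f; apply/cvg_cfunP => K e cK e0.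
have [r r0 hr] := cfun_bounded h cK.
have rC : 0 < ((r%:C)%C : C) by rewrite ltcR.
have := (@cvg_cfunP _ _ (nbhs f) f (nbhs_filter f)).1 (fun A => id) K
  (e / ((r%:C)%C : C)) cK (divr_gt0 e0 rC).
apply: filterS => g fg x Kx; rewrite /= -mulrBl normrM.
have [->|h0] := eqVneq (h x) 0; first by rewrite normr0 mulr0.
apply: lt_le_trans (_ : e / ((r%:C)%C : C) * `|h x| <= e).
  by rewrite ltr_pM2r ?normr_gt0 //; exact: fg.
by rewrite mulrAC ler_pdivrMr // ler_pM2l // ltW // hr.
Qed.

Lemma nbhs_cmeasureP (nu : M) (A : set M) : nbhs nu A ->
  exists (s : seq E) (e : C), 0 < e /\
    [set mu : M | forall f, f \in s -> `|nu f - mu f| < e] `<=` A.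
Proof.
pose F := filter_from [set se : seq E * C | 0 < se.2]
  (fun se => [set mu : M | forall f, f \in se.1 -> `|nu f - mu f| < se.2]).
have FF : Filter F.
  apply: filter_from_filter; first by exists ([::], 1) => /=.
  move=> [s e] [t d] /= e0 d0; exists (s ++ t, Num.min e d).
    by rewrite /= minElt; case: ifP.
  move=> mu /= H; split=> f fs.
    apply: lt_le_trans (H f _) _; first by rewrite mem_cat fs.
    by rewrite comparable_ge_min ?lexx // real_comparable // gtr0_real.
  apply: lt_le_trans (H f _) _; first by rewrite mem_cat fs orbT.
  by rewrite comparable_ge_min ?lexx ?orbT // real_comparable // gtr0_real.
have : F --> nu.
  move=> B; rewrite /nbhs /= => -[_ [[U Uop <-] Unu UB]].
  have FU : {ptws, cmeasure_val @ F --> cmeasure_val nu}.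
    apply/pointwise_cvgP => f; apply/cvgrPdist_lt => e e0.
    by exists ([:: f], e) => //= mu; apply; rewrite inE.
  by apply: (filterS UB); apply: FU; exact: open_nbhs_nbhs.
by move=> /[apply] -[[s e] /= e0 sA]; exists s, e.
Qed.

Definition is_cmeasure_subspace (I : set M) : Prop :=
  [/\ I 0, forall mu nu, I mu -> I nu -> I (mu + nu) &
      forall c mu, I mu -> I (cmeasure_scale c mu)].

Lemma bipolar_seq (s : seq E) (I : set M) (nu : M) : is_cmeasure_subspace I ->
  (forall f, (forall mu, I mu -> mu f = 0) -> nu f = 0) ->
  exists2 mu, I mu & forall f, f \in s -> mu f = nu f.
Proof.
elim: s I nu => [|f s IH] I nu sI H; first by case: sI => I0 _ _; exists 0.
have [If|/existsNP[mu1 /not_implyP[Imu1 mu1f]]] :=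
    pselect (forall mu, I mu -> mu f = 0).
  have [mu Imu mus] := IH I nu sI H; exists mu => // g.
  by rewrite inE => /predU1P[->|]; [rewrite If ?H|exact: mus].
case: (sI) => I0 ID IZ.
pose mu2 := cmeasure_scale (mu1 f)^-1 mu1.
have Imu2 : I mu2 by exact: IZ.
have mu2f : mu2 f = 1 by rewrite /= mulVf //; exact/eqP.
pose I' := [set mu | I mu /\ mu f = 0].
have sI' : is_cmeasure_subspace I'.
  split=> [|mu mu' [Imu muf] [Imu' mu'f]|c mu [Imu muf]]; split => //=.
  - exact: ID.
  - by rewrite muf mu'f addr0.
  - exact: IZ.
  - by rewrite muf mulr0.
have [|mu [Imu muf] mus] := IH I' (nu + cmeasure_scale (- nu f) mu2) sI'.
  move=> g I'g.
  have Ig mu : I mu -> mu g = mu f * mu2 g.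
    move=> Imu; have /I'g : I' (mu + cmeasure_scale (- mu f) mu2).
      split; first by apply: ID => //; exact: IZ.
      by rewrite cmeasure_addE cmeasure_scaleE mu2f mulr1 subrr.
    by rewrite cmeasure_addE cmeasure_scaleE mulNr => /eqP; rewrite subr_eq0 => /eqP.
  have : nu (g - mu2 g *: f) = 0.
    by apply: H => mu Imu; rewrite linearB linearZ /= Ig // mulrC subrr.
  rewrite linearB linearZ => /eqP; rewrite subr_eq0 => /eqP nug.
  by rewrite cmeasure_addE cmeasure_scaleE nug mulNr [X in X - _]mulrC subrr.
exists (mu + cmeasure_scale (nu f) mu2); first by apply: ID => //; exact: IZ.
move=> g; rewrite inE cmeasure_addE cmeasure_scaleE => /predU1P[->|gs].
  by rewrite muf mu2f mulr1 add0r.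
by rewrite mus // cmeasure_addE cmeasure_scaleE mulNr subrK.
Qed.

Lemma bipolar (I : set M) (nu : M) : is_cmeasure_subspace I -> closed I ->
  (forall f, (forall mu, I mu -> mu f = 0) -> nu f = 0) -> I nu.
Proof.
move=> sI cI H; apply: cI => A /nbhs_cmeasureP[s [e [e0 sA]]].
have [mu Imu mus] := bipolar_seq s sI H.
by exists mu; split => //; apply: sA => f fs; rewrite mus // subrr normr0.
Qed.

End cmeasure_operations.

(** * Commuting matrices and unipotent logarithms *)


Section nilpotent_products.
Variables (F : fieldType) (n : nat).
Implicit Types X Y : 'M[F]_n.

Lemma ltn_rank_mul_nilpotent X Y k : comm_mx X Y -> Y ^+ k = 0 -> X != 0 ->
  (\rank (X *m Y) < \rank X)%N.
Proof.
move=> cXY Yk X0; rewrite ltn_neqAle mxrankM_maxl andbT.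
have sXY : (X *m Y <= X)%MS by rewrite cXY submxMl.
apply: contra X0 => /eqP rXY.
have sX : (X <= X *m Y)%MS by rewrite -(geq_leqif (mxrank_leqif_sup sXY)) rXY.
have {}sX j : (X <= X *m (Y ^+ j))%MS.
  elim: j => [|j IH]; first by rewrite expr0 mulmx1.
  by apply: (submx_trans sX); rewrite exprSr -mulmxE mulmxA submxMr.
by have := sX k; rewrite Yk mulmx0 submx0.
Qed.

Lemma rank_prod_nilpotent (s : seq 'M[F]_n) :
  {in s &, forall X Y, comm_mx X Y} -> {in s, forall X, exists k, X ^+ k = 0} ->
  (\rank (\prod_(X <- s) X)%R <= n - size s)%N.
Proof.
elim: s => [|Y s IH] cs ns; first by rewrite subn0 rank_leq_row.
rewrite big_cons /= subnS; set X := \prod_(Z <- s) Z.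
have {}IH : (\rank X <= n - size s)%N.
  apply: IH => [U V Us Vs|U Us]; first by apply: cs; rewrite inE ?Us ?Vs orbT.
  by apply: ns; rewrite inE Us orbT.
have cXY : comm_mx X Y.
  rewrite /X big_seq; apply: (big_ind (fun Z => comm_mx Z Y)) => [|U V UY VY|Z Zs].
  - exact/comm_mx_sym/comm_mx1.
  - by apply/comm_mx_sym/comm_mxM; exact/comm_mx_sym.
  - by apply: cs; rewrite inE ?eqxx // Zs orbT.
have [->|X0] := eqVneq X 0; first by rewrite mulr0 mxrank0.
have [k Yk] := ns Y (mem_head _ _).
have := ltn_rank_mul_nilpotent cXY Yk X0; rewrite cXY -mulmxE.
by move=> /leq_trans /(_ IH); case: (n - size s)%N.
Qed.

Lemma prod_nilpotent_eq0 (s : seq 'M[F]_n) :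
  {in s &, forall X Y, comm_mx X Y} -> {in s, forall X, exists k, X ^+ k = 0} ->
  (n <= size s)%N -> \prod_(X <- s) X = 0.
Proof.
move=> cs ns /eqP sn; have := rank_prod_nilpotent cs ns.
by rewrite sn leqn0 mxrank_eq0 => /eqP.
Qed.

End nilpotent_products.

Lemma fitting_decomposition (F : closedFieldType) (n : nat) (A : 'M[F]_n) :
  (forall a k, (A - a%:M) ^+ k != 0) ->
  exists U V : 'M[F]_n, [/\ (\rank U < n)%N, (\rank V < n)%N, (U + V :=: 1%:M)%MS &
    forall B, comm_mx A B -> stablemx U B /\ stablemx V B].
Proof.
case: n A => [|n] A H; first by have := H 0 0; rewrite thinmx0 eqxx.
have /closed_rootP[a pa] : size (char_poly A) != 1 by rewrite size_char_poly.
have [k [q qa pE]] := multiplicity_XsubC (char_poly A) a.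
have p0 : char_poly A != 0 by rewrite -size_poly_eq0 size_char_poly.
rewrite p0 /= in qa.
have cop : coprimep q (('X - a%:P) ^+ k).
  by rewrite coprimep_sym; apply: coprimep_expl; rewrite coprimep_sym coprimep_XsubC.
pose U := kermxpoly A q; pose V := kermxpoly A (('X - a%:P) ^+ k).
have sUV : (U + V :=: 1%:M)%MS.
  apply: (eqmx_trans (eqmx_sym (kermxpolyM A cop))).
  by rewrite -pE; apply: kermxpoly_min; exact: mxminpoly_dvd_char.
have UV0 := mxdirect_kermxpoly A cop.
have rUV : (\rank U + \rank V = n.+1)%N.
  by rewrite -(mxrank_disjoint_sum UV0) sUV mxrank1.
have k0 : (0 < k)%N.
  case: k => [|//] in pE cop V sUV UV0 rUV *.
  by move: qa; rewrite expr0 mulr1 in pE; rewrite -pE pa.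
have V0 : V != 0.
  have /eigenvalueP[v vA v0] : eigenvalue A a by rewrite eigenvalue_root_char.
  apply: contra v0 => /eqP V0; rewrite -submx0 -V0 /V.
  apply/sub_kermxP; rewrite -(prednK k0) exprS rmorphM /= rmorphB /= horner_mx_X horner_mx_C.
  by rewrite -mulmxE mulmxA mulmxBr vA mul_mx_scalar subrr mul0mx.
have Vn : (\rank V < n.+1)%N.
  rewrite ltn_neqAle rank_leq_row andbT; apply: contra (H a k) => /eqP rV.
  have /submxP[D] : (1%:M <= V)%MS by rewrite sub1mx /row_full rV.
  move=> /(congr1 (mulmx^~ ((A - a%:M) ^+ k))); rewrite mul1mx => ->.
  have -> : (A - a%:M) ^+ k = horner_mx A (('X - a%:P) ^+ k).
    by rewrite rmorphXn /= rmorphB /= horner_mx_X horner_mx_C.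
  by rewrite -mulmxA mulmx_ker mulmx0.
exists U, V; split=> //.
  have V_gt0 : (0 < \rank V)%N by rewrite lt0n mxrank_eq0.
  by move: V_gt0; rewrite -(ltn_add2l (\rank U)) addn0 rUV.
by move=> B AB; split; exact: comm_mx_stable_kermxpoly.
Qed.

Section binomial_poly.
Variable F : numFieldType.

Definition binomial_poly k : {poly F} := (k`!%:R)^-1 *: \prod_(i < k) ('X - i%:R%:P).

Lemma horner_binomial_poly k (s : nat) : (binomial_poly k).[s%:R] = 'C(s, k)%:R.
Proof.
rewrite hornerZ horner_prod.
have -> : \prod_(i < k) ('X - i%:R%:P : {poly F}).[s%:R] = (s ^_ k)%:R.
  elim: k => [|k IH]; first by rewrite big_ord0 ffactn0.
  rewrite big_ord_recr /= {}IH ffactnSr natrM hornerXsubC.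
  have [ks|sk] := leqP k s; first by rewrite natrB.
  by rewrite ffact_small // !mul0r.
rewrite -bin_ffact natrM mulrC mulfK // pnatr_eq0 -lt0n; exact: fact_gt0.
Qed.

Lemma poly_eq_nat (p q : {poly F}) : (forall s : nat, p.[s%:R] = q.[s%:R]) -> p = q.
Proof.
move=> pq; apply/eqP; rewrite -subr_eq0; apply/eqP.
apply: (@roots_geq_poly_eq0 _ _ [seq i%:R | i <- iota 0 (size (p - q))]).
- by apply/allP => _ /mapP[i _ ->]; rewrite rootE hornerD hornerN pq subrr.
- by rewrite map_inj_uniq ?iota_uniq // => i j /eqP; rewrite eqr_nat => /eqP.
- by rewrite size_map size_iota.
Qed.

End binomial_poly.

Lemma sum_ord_vanish (V : zmodType) (f : nat -> V) (a b : nat) :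
  (forall i, (a <= i)%N -> f i = 0) -> (forall i, (b <= i)%N -> f i = 0) ->
  \sum_(i < a) f i = \sum_(i < b) f i.
Proof.
have H c d : (c <= d)%N -> (forall i, (c <= i)%N -> f i = 0) ->
    \sum_(i < d) f i = \sum_(i < c) f i.
  move=> cd f0; rewrite -!(big_mkord xpredT) (big_cat_nat (leq0n c) cd) /=.
  by rewrite [X in _ + X]big_nat [X in _ + X]big1 ?addr0 // => i /andP[/f0].
move=> fa fb; have [ab|/ltnW ba] := leqP a b; first exact/esym/H.
exact: H.
Qed.

(* The logarithm of a unipotent one-parameter family is read off the polynomial
   [t |-> \sum_k binom(t, k) (B x - 1)^k], which interpolates [n |-> B (n x)]. *)
Section unipotent_logarithm.
Variables (F : numFieldType) (T : zmodType) (n N : nat) (B : T -> 'M[F]_n).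
Hypothesis BD : forall x y, B (x + y) = B x *m B y.
Hypothesis B_unipotent : forall x, (B x - 1%:M) ^+ N = 0.

Let interp x : 'M[{poly F}]_n :=
  \sum_(k < N) binomial_poly F k *: map_mx polyC ((B x - 1%:M) ^+ k).

Let eval (t : F) (A : 'M[{poly F}]_n) : 'M[F]_n := map_mx (horner_eval t) A.

Let evalC t (A : 'M[F]_n) : eval t (map_mx polyC A) = A.
Proof. by apply/matrixP => i j; rewrite !mxE /horner_eval hornerC. Qed.

Let evalM t A A' : eval t (A *m A') = eval t A *m eval t A'.
Proof. exact: map_mxM. Qed.

Let eval_inj A A' : (forall s : nat, eval s%:R A = eval s%:R A') -> A = A'.
Proof.
move=> H; apply/matrixP => i j; apply: poly_eq_nat => s.
by have /matrixP/(_ i j) := H s; rewrite !mxE.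
Qed.

Let eval_interp x (s : nat) : eval s%:R (interp x) = B x ^+ s.
Proof.
rewrite /eval /interp map_mx_sum.
under eq_bigr => k _ do
  rewrite map_mxZ -/(eval _ _) evalC /= horner_evalE horner_binomial_poly scaler_nat.
rewrite -[in RHS](subrK 1%:M (B x)) exprD1n.
apply: (@sum_ord_vanish _ (fun k => (B x - 1%:M) ^+ k *+ 'C(s, k))) => k hk.
  by rewrite -(subnK hk) exprD B_unipotent mulr0 mul0rn.
by rewrite bin_small // mulr0n.
Qed.

Let BC x y : B x *m B y = B y *m B x. Proof. by rewrite -!BD addrC. Qed.

Definition unipotent_log x : 'M[F]_n := map_mx (coefp 1) (interp x).

Lemma unipotent_logE x i j : unipotent_log x i j =
  \sum_(k < N) (binomial_poly F k)`_1 * ((B x - 1%:M) ^+ k) i j.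
Proof.
rewrite mxE /interp summxE raddf_sum; apply: eq_bigr => k _.
by rewrite !mxE /= coefMC.
Qed.

Let interp0 x : map_mx (coefp 0) (interp x) = 1%:M.
Proof.
rewrite -[RHS]/(B x ^+ 0) -eval_interp; apply/matrixP => i j.
by rewrite !mxE /= /horner_eval horner_coef0.
Qed.

Lemma unipotent_logD x y : unipotent_log (x + y) = unipotent_log x + unipotent_log y.
Proof.
have E : interp (x + y) = interp x *m interp y.
  apply: eval_inj => s; rewrite evalM !eval_interp BD.
  by rewrite -[B x *m B y]/(B x * B y) exprMn_comm //; exact: BC.
have -> : unipotent_log x + unipotent_log y =
    unipotent_log x *m map_mx (coefp 0) (interp y) +
    map_mx (coefp 0) (interp x) *m unipotent_log y.
  by rewrite !interp0 mulmx1 mul1mx.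
rewrite /unipotent_log E; apply/matrixP => i j; rewrite !mxE raddf_sum -big_split.
apply: eq_bigr => k _ /=; rewrite coefM !big_ord_recl big_ord0 addr0 !mxE /= addrC.
by rewrite /bump /= subn0.
Qed.

Let interp_deriv x : map_mx (@deriv F) (interp x) = map_mx polyC (unipotent_log x) *m interp x.
Proof.
apply: eval_inj => s; rewrite evalM evalC eval_interp.
have E : map_mx (fun p => p \Po ('X + s%:R%:P)) (interp x) =
    interp x *m map_mx polyC (B x ^+ s).
  apply: eval_inj => t; rewrite evalM evalC eval_interp mulmxE -exprD -eval_interp.
  by apply/matrixP => i j; rewrite !mxE /horner_eval horner_comp !hornerE natrD.
apply/matrixP => i j; have /matrixP/(_ i j)/(congr1 (fun p : {poly F} => p`_1)) := E.
rewrite !mxE coef_sum.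
have -> (p : {poly F}) : (p \Po ('X + s%:R%:P))`_1 = p^`().[s%:R].
  rewrite -[LHS]/((_ \Po _)`_0.+1) -[LHS]mulr1n -coef_deriv -horner_coef0 deriv_comp.
  by rewrite !(derivE, hornerE) horner_comp !hornerE.
rewrite /horner_eval => ->; apply: eq_bigr => k _.
by rewrite !mxE coefMC.
Qed.

Lemma unipotent_exp : exists J, forall x,
  B x = \sum_(j < J) (j`!%:R)^-1 *: unipotent_log x ^+ j.
Proof.
pose J := (\max_(k < N) size (binomial_poly F k))%N; exists J => x.
have coefJ i j l : (J <= l)%N -> (interp x i j)`_l = 0.
  move=> Jl; rewrite /interp summxE coef_sum big1 // => k _.
  rewrite !mxE coefMC nth_default ?mul0r //.
  exact: leq_trans (leq_bigmax (F := fun k : 'I_N => size (binomial_poly F k)) k) Jl.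
have coefE j : map_mx (coefp j) (interp x) = (j`!%:R)^-1 *: unipotent_log x ^+ j.
  elim: j => [|j IH]; first by rewrite expr0 fact0 invr1 scale1r interp0.
  have : j.+1%:R *: map_mx (coefp j.+1) (interp x) =
      unipotent_log x *m map_mx (coefp j) (interp x).
    apply/matrixP => a b.
    have /matrixP/(_ a b)/(congr1 (fun p : {poly F} => p`_j)) := interp_deriv x.
    rewrite !mxE coef_deriv coef_sum /= mulr_natl => ->.
    by apply: eq_bigr => k _; rewrite !mxE coefCM.
  move=> /(congr1 (GRing.scale (j.+1%:R)^-1)); rewrite scalerA mulVf ?pnatr_eq0 // scale1r.
  by rewrite IH -scalemxAr scalerA mulmxE -exprS factS natrM invfM => ->.
under eq_bigr => j _ do rewrite -coefE.
rewrite -[LHS]expr1 -eval_interp; apply/matrixP => a b.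
have -> : eval 1%:R (interp x) a b = (interp x a b).[1%:R] by rewrite mxE.
rewrite [RHS]summxE (@horner_coef_wide _ J); last by apply/leq_sizeP => l; exact: coefJ.
by apply: eq_bigr => j _; rewrite !mxE expr1n mulr1.
Qed.

End unipotent_logarithm.

(** * Finite dimensional spaces of functions *)


Section finite_dimensional_subspaces.
Context {R : realType} {G : topologicalZmodType}.
Local Notation C := (cplx R).
Local Notation E := (cfun R G).
Local Notation M := (cmeasure R G).

Lemma cfun_sumE (T : Type) (s : seq T) (f : T -> E) x :
  (\sum_(i <- s) f i) x = \sum_(i <- s) f i x.
Proof. by elim/big_rec2: _ => // i a b _ <-. Qed.

Lemma cmeasure_sumE (T : Type) (s : seq T) (mu : T -> M) f :
  (\sum_(i <- s) mu i) f = \sum_(i <- s) mu i f.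
Proof. by elim/big_rec2: _ => // i a b _ <-. Qed.

Lemma subspaceZ (W : set E) a f : is_subspace W -> W f -> W (a *: f).
Proof. by move=> [W0 WD] Wf; rewrite -[_ *: _]addr0; exact: WD. Qed.

Lemma subspaceD (W : set E) f g : is_subspace W -> W f -> W g -> W (f + g).
Proof. by move=> [W0 WD] Wf Wg; rewrite -[f]scale1r; exact: WD. Qed.

Lemma subspace_sum (W : set E) (T : Type) (s : seq T) (c : T -> C) (f : T -> E) :
  is_subspace W -> (forall i, W (f i)) -> W (\sum_(i <- s) c i *: f i).
Proof.
move=> sW Wf; apply: (big_ind W) => [|g h|i _]; first exact: sW.1.
  exact: subspaceD.
exact: subspaceZ.
Qed.

Lemma dual_basis (W : set E) : is_subspace W -> finite_dimensional W ->
  exists r (g : 'I_r -> E) (lam : 'I_r -> M),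
    [/\ forall i, W (g i), forall i j, lam i (g j) = (i == j)%:R &
        forall f, W f -> f = \sum_(i < r) lam i f *: g i].
Proof.
move=> + [n [e]]; elim: n W e => [|n IH] W e sW We.
  exists 0, (fun=> 0), (fun=> 0); split=> [[]|[]|f /We[c ->]] //.
  by rewrite !big_ord0.
have [W0|/existsNP[g0 /not_implyP[Wg0 g0N]]] := pselect (forall f, W f -> f = 0).
  exists 0, (fun=> 0), (fun=> 0); split=> [[]|[]|f /W0 ->] //.
  by rewrite big_ord0.
have [x0 g0x] : exists x, g0 x != 0.
  apply: contrapT => H; apply: g0N; apply: cfunP => x; apply/eqP/negPn/negP => gx.
  by apply: H; exists x.
pose g := (g0 x0)^-1 *: g0.
have Wg : W g by exact: subspaceZ.
have gx : g x0 = 1 by rewrite cfunZE mulVf.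
pose W' := [set f | W f /\ f x0 = 0].
have sW' : is_subspace W'.
  split=> [|a f h [Wf fx] [Wh hx]]; split=> //; first exact: sW.1.
    exact: sW.2.
  by rewrite cfunDE cfunZE fx hx mulr0 addr0.
have [i0 ei0] : exists i, e i x0 != 0.
  apply: contrapT => H; have := gx; have [c ->] := We g Wg.
  rewrite cfun_sumE big1 => [/esym/eqP|i _]; first by rewrite oner_eq0.
  rewrite cfunZE; have [->|ei] := eqVneq (e i x0) 0; first by rewrite mulr0.
  by case: H; exists i.
pose e' j := e (lift i0 j) - (e (lift i0 j) x0 / e i0 x0) *: e i0.
have [|r [g' [lam' [W'g' lg' W'f]]]] := IH W' e' sW'.
  move=> f [Wf fx]; have [c fE] := We f Wf.
  exists (fun j => c (lift i0 j)).
  have := fx; rewrite fE cfun_sumE (bigD1_ord i0) //= cfunZE.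
  under eq_bigr => j _ do rewrite cfunZE.
  move=> /eqP; rewrite addr_eq0 => /eqP ci0.
  rewrite (bigD1_ord i0) //= addrC.
  under [RHS]eq_bigr => j _ do rewrite scalerBr scalerA mulrA.
  rewrite big_split /= sumrN -scaler_suml -mulr_suml; congr (_ + _).
  by rewrite -scaleNr -mulNr -ci0 mulfK.
exists r.+1, (fun i => if unlift ord0 i is Some j then g' j else g),
  (fun i => if unlift ord0 i is Some j then
              lam' j + cmeasure_scale (- lam' j g) (dirac x0) else dirac x0).
split=> [i|i j|f Wf] /=.
- by case: unliftP => // j _; exact: (W'g' j).1.
- case: (unliftP ord0 i) => [i'|] ->; case: (unliftP ord0 j) => [j'|] ->.
  + rewrite cmeasure_addE cmeasure_scaleE lg' [dirac _ _](W'g' j').2 mulr0 addr0.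
    by rewrite (inj_eq lift_inj).
  + by rewrite cmeasure_addE cmeasure_scaleE [dirac _ _]gx mulr1 subrr.
  + by rewrite [dirac _ _](W'g' j').2.
  + by rewrite [dirac _ _]gx eqxx.
rewrite big_ord_recl unlift_none.
under eq_bigr => j _ do rewrite liftK.
have W'h : W' (f - f x0 *: g).
  split; last by rewrite cfunDE cfunNE cfunZE gx mulr1 subrr.
  by rewrite -scaleNr addrC; exact: sW.2.
rewrite -[LHS](subrK (f x0 *: g)) addrC [in LHS](W'f _ W'h); congr (_ + _).
apply: eq_bigr => j _; congr (_ *: _).
by rewrite cmeasure_addE cmeasure_scaleE linearB linearZ /= mulNr [X in _ - X]mulrC.
Qed.

Lemma finite_dimensional_closed (W : set E) :
  is_subspace W -> finite_dimensional W -> closed W.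
Proof.
move=> sW fW; have [r [g [lam [Wg _ Wf]]]] := dual_basis sW fW.
pose mu x := dirac x + \sum_(i < r) cmeasure_scale (- g i x) (lam i).
have muE x f : mu x f = f x - (\sum_(i < r) lam i f *: g i) x.
  rewrite cmeasure_addE cmeasure_sumE cfun_sumE -sumrN; congr (_ + _).
  by apply: eq_bigr => i _; rewrite cmeasure_scaleE cfunZE mulNr mulrC.
have -> : W = \bigcap_(x in setT) [set f | mu x f = 0].
  apply/seteqP; split=> f; first by move=> /Wf fE x _; have := muE x f; rewrite -fE subrr.
  move=> H; have -> : f = \sum_(i < r) lam i f *: g i.
    apply: cfunP => x; apply/eqP; rewrite -subr_eq0 -muE; apply/eqP; exact: H.
  exact: subspace_sum.
by apply: closed_bigI => x _; exact: closed_kernel.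
Qed.

Definition finite_orbit (f : G -> C) : Prop :=
  exists (T : finType) (g : T -> E), forall y, exists c : T -> C,
    forall x, f (y + x) = \sum_t c t * g t x.

Lemma finite_orbit_cst (c : C) : finite_orbit (fun=> c).
Proof.
exists unit, (fun=> mkcfun (fun x => cvg_cst (1 : C))) => y; exists (fun=> c) => x.
by rewrite big_const card_unit /= mulr1 addr0.
Qed.

Lemma finite_orbitD f g : finite_orbit f -> finite_orbit g ->
  finite_orbit (fun x => f x + g x).
Proof.
move=> [T [e fe]] [S [d gd]].
exists (T + S)%type, (fun i => match i with inl t => e t | inr s => d s end) => y.
have [c cE] := fe y; have [b bE] := gd y.
exists (fun i => match i with inl t => c t | inr s => b s end) => x.
by rewrite cE bE big_sumType.
Qed.

Lemma finite_orbitM f g : finite_orbit f -> finite_orbit g ->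
  finite_orbit (fun x => f x * g x).
Proof.
move=> [T [e fe]] [S [d gd]].
exists (T * S)%type, (fun i => cfun_mul (e i.1) (d i.2)) => y.
have [c cE] := fe y; have [b bE] := gd y.
exists (fun i => c i.1 * b i.2) => x.
rewrite cE bE big_distrlr pair_bigA; apply: eq_bigr => -[t s] _ /=.
by rewrite mulrACA.
Qed.

Lemma finite_orbit_ext f g : f =1 g -> finite_orbit f -> finite_orbit g.
Proof. by move=> /funext ->. Qed.

Lemma finite_orbit_exponential (m : exponential R G) : finite_orbit (exponential_fun m).
Proof.
exists unit, (fun=> exponential_fun m) => y; exists (fun=> exponential_fun m y) => x.
by rewrite big_const card_unit /= addr0 exponentialD.
Qed.

Lemma finite_orbit_additive (a : E) : additive_function a -> finite_orbit a.
Proof.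
move=> aD; exists bool, (fun b => if b then a else mkcfun (fun x => cvg_cst (1 : C))) => y.
exists (fun b => if b then 1 else a y) => x.
by rewrite big_bool /= mul1r mulr1 aD addrC.
Qed.

Lemma finite_orbit_polynomial (p : E) : polynomial_function p -> finite_orbit p.
Proof.
move=> [k [a [P [aD pE]]]]; apply: finite_orbit_ext (fsym pE) _.
pose F x := \sum_(m <- mpoly.msupp P)
  mpoly.mcoeff m P * \prod_(i < k) a i x ^+ mpoly.fun_of_multinom m i.
apply: (@finite_orbit_ext F); first by move=> x; rewrite mpoly.mevalE.
rewrite /F; elim: (mpoly.msupp P) => [|m s IH].
  by apply: finite_orbit_ext (finite_orbit_cst 0) => x; rewrite big_nil.
pose H x := mpoly.mcoeff m P * \prod_(i < k) a i x ^+ mpoly.fun_of_multinom m i.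
apply: (@finite_orbit_ext (fun x => H x + \sum_(m <- s)
  mpoly.mcoeff m P * \prod_(i < k) a i x ^+ mpoly.fun_of_multinom m i)).
  by move=> x; rewrite big_cons.
apply: finite_orbitD IH; apply: finite_orbitM; first exact: finite_orbit_cst.
elim: (index_enum _) => [|i t IH].
  by apply: finite_orbit_ext (finite_orbit_cst 1) => x; rewrite big_nil.
apply: (@finite_orbit_ext (fun x => a i x ^+ mpoly.fun_of_multinom m i *
  \prod_(i <- t) a i x ^+ mpoly.fun_of_multinom m i)) => [x|].
  by rewrite big_cons.
apply: finite_orbitM IH; elim: (mpoly.fun_of_multinom m i) => [|j IH].
  by apply: finite_orbit_ext (finite_orbit_cst 1) => x; rewrite expr0.
apply: (@finite_orbit_ext (fun x => a i x * a i x ^+ j)) => [x|]; first by rewrite exprS.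
by apply: finite_orbitM IH; exact: finite_orbit_additive.
Qed.

Lemma cfun_translateE y (f : E) x : cfun_translate y f x = f (y + x).
Proof. by []. Qed.

Lemma continuous_cfun_translate y : continuous (@cfun_translate R G y).
Proof.
have cy : continuous (fun x : G => y + x).
  by move=> x; exact: (cvg_comp2 (cvg_cst y) cvg_id (@add_continuous G (y, x))).
have -> : @cfun_translate R G y = cfun_comp cy.
  by apply/funext => f; exact: cfunP.
exact: continuous_cfun_comp.
Qed.

Lemma finite_orbit_variety (V : set E) (f : E) : is_variety V -> V f -> finite_orbit f ->
  exists W, [/\ is_variety W, finite_dimensional W, W `<=` V & W f].
Proof.
move=> [sV cV tV] Vf [T [g fg]].
pose S : set E := [set h | exists c : T -> C, h = \sum_t c t *: g t].
have sS : is_subspace S.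
  split; first by exists (fun=> 0); rewrite big1 // => t _; rewrite scale0r.
  move=> a _ _ [c ->] [d ->]; exists (fun t => a * c t + d t).
  rewrite scaler_sumr -big_split; apply: eq_bigr => t _.
  by rewrite scalerDl scalerA.
have fS : finite_dimensional S.
  exists #|T|, (g \o enum_val) => _ [c ->]; exists (c \o enum_val).
  by rewrite (reindex (@enum_val T predT)) //; exact/onW_bij/enum_val_bij.
have cS := finite_dimensional_closed sS fS.
pose W := V `&` \bigcap_(y in setT) (@cfun_translate R G y @^-1` S).
have t0 (h : E) : cfun_translate 0 h = h by apply: cfunP => x; rewrite cfun_translateE add0r.
have tD (y z : G) (h : E) : cfun_translate y (cfun_translate z h) = cfun_translate (z + y) h.
  by apply: cfunP => x; rewrite [LHS]cfun_translateE [LHS]cfun_translateE addrA.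
exists W; split.
- split.
  + split=> [|a h k [Vh Sh] [Vk Sk]].
      split=> [|y _]; first exact: sV.1.
      by rewrite /= (_ : cfun_translate _ _ = 0); [exact: sS.1|exact: cfunP].
    split=> [|y _]; first exact: sV.2.
    rewrite /= (_ : cfun_translate _ _ = a *: cfun_translate y h + cfun_translate y k).
      by apply: sS.2; [exact: Sh|exact: Sk].
    exact: cfunP.
  + apply: closedI => //; apply: closed_bigI => y _.
    by apply: preimage_closed => // h _; exact: continuous_cfun_translate.
  + move=> y h [Vh Sh]; split; first exact: tV.
    by move=> z _; rewrite /= tD; exact: Sh.
- have [n [e Se]] := fS; exists n, e => h [_ Sh]; apply: Se.
  by rewrite -(t0 h); exact: (Sh 0).
- by move=> h [].
- split=> // y _; have [c cE] := fg y; exists c; apply: cfunP => x.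
  by rewrite cfun_sumE [LHS]cE; apply: eq_bigr => t _; rewrite cfunZE.
Qed.

End finite_dimensional_subspaces.

(** * Matrix representations *)


Section matrix_representations.
Context {R : realType} {G : topologicalZmodType}.
Local Notation C := (cplx R).
Local Notation E := (cfun R G).

Lemma continuous_ext (f g : G -> C) : f =1 g -> continuous f -> continuous g.
Proof. by move=> /funext ->. Qed.

Lemma continuous_sum (T : Type) (s : seq T) (f : T -> G -> C) :
  (forall i, continuous (f i)) -> continuous (fun x => \sum_(i <- s) f i x).
Proof.
move=> cf; apply: continuous_ext (@cfun_continuous _ _ (\sum_(i <- s) mkcfun (cf i))).
by move=> x; rewrite cfun_sumE.
Qed.

Lemma continuous_mul (f g : G -> C) : continuous f -> continuous g ->
  continuous (fun x => f x * g x).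
Proof. by move=> cf cg; exact: (@cfun_mul_subproof _ _ (mkcfun cf) (mkcfun cg)). Qed.

Definition entries_continuous m n (A : G -> 'M[C]_(m, n)) : Prop :=
  forall i j, continuous (fun x => A x i j).

Lemma entries_continuous_cst m n (A : 'M[C]_(m, n)) : entries_continuous (fun=> A).
Proof. by move=> i j x; exact: cvg_cst. Qed.

Lemma entries_continuousM m n p (A : G -> 'M[C]_(m, n)) (B : G -> 'M[C]_(n, p)) :
  entries_continuous A -> entries_continuous B ->
  entries_continuous (fun x => A x *m B x).
Proof.
move=> cA cB i j.
have := @continuous_sum _ (index_enum 'I_n) (fun k x => A x i k * B x k j)
  (fun k => continuous_mul (cA i k) (cB k j)).
by apply: continuous_ext => x; rewrite mxE.
Qed.

Record matrix_rep n (A : G -> 'M[C]_n) : Prop := MatrixRep {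
  rep_continuous : entries_continuous A;
  rep0 : A 0 = 1%:M;
  repD : forall x y, A (x + y) = A x *m A y }.

Arguments rep_continuous {n A} _ _ _.

Lemma rep_comm n (A : G -> 'M[C]_n) x y : matrix_rep A -> comm_mx (A x) (A y).
Proof. by move=> rA; rewrite /comm_mx -!repD // addrC. Qed.

Lemma comm_mxBscalar n (A B : 'M[C]_n) a b :
  comm_mx A B -> comm_mx (A - a%:M) (B - b%:M).
Proof.
move=> AB; apply: comm_mxB; last exact: comm_mx_scalar.
by apply/comm_mx_sym/comm_mxB; [exact/comm_mx_sym|exact: comm_mx_scalar].
Qed.

Lemma unipotent_nilpotent_order n (A : 'M[C]_n) k : A ^+ k = 0 -> A ^+ n = 0.
Proof.
move=> Ak.
have <- : \prod_(X <- nseq n A) X = A ^+ n by rewrite big_nseq -[RHS]mulr1 iter_mulr.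
apply: prod_nilpotent_eq0; last by rewrite size_nseq.
  by move=> X Y /nseqP[-> _] /nseqP[-> _].
by move=> X /nseqP[-> _]; exists k.
Qed.

Section unipotent.
Import -(notations) mpoly.
Variables (n : nat) (B : G -> 'M[C]_n).
Hypothesis repB : matrix_rep B.
Hypothesis uB : forall x, exists k, (B x - 1%:M) ^+ k = 0.

Let uBn x : (B x - 1%:M) ^+ n = 0.
Proof. by have [k] := uB x; exact: unipotent_nilpotent_order. Qed.

Let logB := unipotent_log n B.

Lemma unipotent_log_continuous : entries_continuous logB.
Proof.
have cX k : entries_continuous (fun x => (B x - 1%:M) ^+ k).
  elim: k => [|k IH]; first exact: entries_continuous_cst.
  have cB : entries_continuous (fun x => B x - 1%:M).
    move=> i j.
    have := @cfun_continuous _ _ (mkcfun (rep_continuous repB i j) -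
      mkcfun (@entries_continuous_cst _ _ 1%:M i j)).
    by apply: continuous_ext => x; rewrite [RHS]mxE [X in _ = _ + X]mxE.
  have := entries_continuousM cB IH.
  by congr entries_continuous; apply/funext => x; rewrite exprS.
move=> i j.
have := @continuous_sum _ (index_enum 'I_n)
  (fun k x => (binomial_poly C k)`_1 * ((B x - 1%:M) ^+ k) i j)
  (fun k => continuous_mul (@cst_continuous _ _ _) (cX k i j)).
by apply: continuous_ext => x; rewrite unipotent_logE.
Qed.

Lemma unipotent_coefficient (c : 'rV[C]_n) (v : 'cV[C]_n) :
  exists D : diff_operator R G, polynomial_operator D /\
    forall x, generating_function D x = (c *m B x *m v) 0 0.
Proof.
have cq : continuous (fun x => (c *m B x *m v) 0 0).
  exact: (entries_continuousM (entries_continuousM (@entries_continuous_cst _ _ c)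
    (rep_continuous repB)) (@entries_continuous_cst _ _ v)).
pose q : E := mkcfun cq.
have dq (s : seq G) x : foldr (fun z g => act (difference_measure z) g) q s x =
    (c *m B x *m (\prod_(y <- s) (B y - 1%:M)) *m v) 0 0.
  elim: s x => [|y s IH] x; first by rewrite big_nil mulmx1.
  rewrite [LHS]act_difference_measure !IH big_cons (repD repB).
  by rewrite -mulmxE mulmxBl mul1mx mulmxBr mulmxBl !mulmxA [RHS]mxE [X in _ = _ + X]mxE.
have gq : generalized_polynomial q.
  exists n => y; apply: cfunP => x; rewrite dq -(big_map (fun y => B y - 1%:M) xpredT id).
  rewrite prod_nilpotent_eq0 ?mulmx0 ?mul0mx ?mxE //; last by rewrite size_map size_tuple.
    by move=> _ _ /mapP[z _ ->] /mapP[w _ ->]; apply/comm_mxBscalar/rep_comm.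
  by move=> _ /mapP[z _ ->]; exact: uB.
exists (DiffOperator gq); split=> //.
have [J BE] := unipotent_exp uBn.
pose X : 'M[mpoly.mpoly (n * n) C]_n := \matrix_(i, j) mpoly.mpolyX _ (mpoly.mnm1 (mxvec_index i j)).
pose cst : C -> mpoly.mpoly (n * n) C := @mpoly.mpolyC (n * n) C.
pose S := \sum_(j < J) cst (j`!%:R)^-1 *: X ^+ j.
pose P := (map_mx cst c *m S *m map_mx cst v) 0 0.
have ca k : continuous (fun x => mxvec (logB x) 0 k).
  case/mxvec_indexP: k => i j.
  have := @unipotent_log_continuous i j.
  by apply: continuous_ext => x; rewrite mxvecE.
exists (n * n)%N, (fun k => mkcfun (ca k)), P; split=> [k x y|x].
  by rewrite /= -[LHS]/(mxvec (logB (x + y)) 0 k) /logB (unipotent_logD (repD repB) uBn) linearD mxE.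
rewrite /= -[LHS]/((c *m B x *m v) 0 0).
pose w k := mxvec (logB x) 0 k.
have evC m p (A : 'M[C]_(m, p)) :
    map_mx (mpoly.meval w) (map_mx cst A) = A.
  by apply/matrixP => i j; rewrite !mxE mpoly.mevalC.
have evX : map_mx (mpoly.meval w) X = logB x.
  by apply/matrixP => i j; rewrite [LHS]mxE [X i j]mxE mpoly.mevalXU /w mxvecE.
have evXn j : map_mx (mpoly.meval w) (X ^+ j) = logB x ^+ j.
  elim: j => [|j IH]; first by rewrite !expr0 map_mx1.
  by rewrite exprS -mulmxE map_mxM IH evX mulmxE -exprS.
have evS : map_mx (mpoly.meval w) S = B x.
  rewrite BE /S map_mx_sum; apply: eq_bigr => j _.
  by rewrite map_mxZ evXn /= mpoly.mevalC.
transitivity (map_mx (mpoly.meval w) (map_mx cst c *m S *m map_mx cst v) 0 0).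
  by rewrite (map_mxM _ (_ *m S) _) (map_mxM _ _ S) evS !evC.
by rewrite mxE.
Qed.

End unipotent.

Lemma common_generalized_eigenvalue n (A : G -> 'M[C]_n.+1) : matrix_rep A ->
  (forall x, exists a k, (A x - a%:M) ^+ k = 0) ->
  exists m : exponential R G, forall x, exists k, (A x - (exponential_fun m x)%:M) ^+ k = 0.
Proof.
move=> rA /choice[a aN].
pose N y := A y - (a y)%:M.
have cN y z : comm_mx (N y) (N z) by apply/comm_mxBscalar/rep_comm.
pose rankP r := `[< exists2 s : seq G, \prod_(y <- s) N y != 0 &
  \rank (\prod_(y <- s) N y)%R = r >].
have exP : exists r, rankP r.
  exists (\rank (\prod_(y <- [::]) N y)%R); apply/asboolP; exists [::] => //.
  by rewrite big_nil oner_eq0.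
case: (ex_minnP exP) => r /asboolP[s]; set X := \prod_(y <- s) N y => X0 rX rmin.
have cX y : comm_mx X (N y).
  rewrite /X; apply: (big_ind (fun Z => comm_mx Z (N y))) => [|U V Uy Vy|z _].
  - exact/comm_mx_sym/comm_mx1.
  - by apply/comm_mx_sym/comm_mxM; exact/comm_mx_sym.
  - exact: cN.
have AX y : A y *m X = a y *: X.
  apply/eqP; rewrite -subr_eq0 -mul_scalar_mx -mulmxBl; apply/negPn/negP => NX0.
  have [k Nk] := aN y.
  have := ltn_rank_mul_nilpotent (cX y) Nk X0.
  rewrite cX rX ltnNge rmin //; apply/asboolP; exists (y :: s); rewrite big_cons //.
have [i [j Xij]] : exists i j, X i j != 0.
  apply: contrapT => H; case/eqP: X0; apply/matrixP => i j; rewrite mxE; apply/eqP/negPn/negP => Xij.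
  by apply: H; exists i, j.
have aE y : a y = (A y *m X) i j * (X i j)^-1 by rewrite AX mxE mulfK.
have ca : continuous a.
  apply: (@continuous_ext (fun y => (A y *m X) i j * (X i j)^-1)) => [y|]; first by rewrite -aE.
  apply: continuous_mul; last exact: cst_continuous.
  exact: (entries_continuousM (rep_continuous rA) (@entries_continuous_cst _ _ X)).
have aD x y : a (x + y) = a x * a y.
  rewrite aE (repD rA) -mulmxA AX -scalemxAr AX scalerA mxE mulfK //.
  exact: mulrC.
have a0 : a 0 = 1 by rewrite aE (rep0 rA) mul1mx divff.
have aN0 x : a x != 0.
  apply/eqP => ax0; have := aD x (- x); rewrite subrr a0 ax0 mul0r => /eqP.
  by rewrite oner_eq0.
by exists (@Exponential R G (mkcfun ca) aN0 aD).
Qed.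

Definition monomial_row n (A : G -> 'M[C]_n) (c : 'rV[C]_n) : Prop :=
  exists m : exponential R G, forall v : 'cV[C]_n, exists D : diff_operator R G,
    polynomial_operator D /\
    forall x, (c *m A x *m v) 0 0 = generating_function D x * exponential_fun m x.

Lemma monomial_row_single n (A : G -> 'M[C]_n) (c : 'rV[C]_n) : matrix_rep A ->
  (0 < n)%N -> (forall x, exists a k, (A x - a%:M) ^+ k = 0) -> monomial_row A c.
Proof.
case: n A c => // n A c rA _ /(common_generalized_eigenvalue rA)[m mN].
exists m => v; set m' := exponential_fun m in mN *.
have m0 x : m' x != 0 by exact: exponential_neq0.
have mD x y : m' (x + y) = m' x * m' y by exact: exponentialD.
have m'0 : m' 0 = 1.
  by apply: (mulfI (m0 0)); rewrite -mD addr0 mulr1.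
pose B x := (m' x)^-1 *: A x.
have cmV : continuous (fun x => (m' x)^-1).
  by move=> x; apply: cvgV; [exact: m0|exact: cfun_continuous].
have rB : matrix_rep B.
  split=> [i j||x y].
  - have := continuous_mul cmV (rep_continuous rA i j).
    by apply: continuous_ext => x; rewrite !mxE.
  - by rewrite /B m'0 invr1 scale1r (rep0 rA).
  - by rewrite /B -scalemxAl -scalemxAr scalerA mD invfM (repD rA).
have uB x : exists k, (B x - 1%:M) ^+ k = 0.
  have [k Nk] := mN x; exists k.
  have -> : B x - 1%:M = (m' x)^-1 *: (A x - (m' x)%:M).
    by rewrite scalerBr scale_scalar_mx mulVf.
  by rewrite exprZn Nk scaler0.
have [D [pD DE]] := unipotent_coefficient rB uB c v.
exists D; split=> // x; rewrite DE /B -scalemxAr -scalemxAl [X in _ = X * _]mxE.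
by rewrite mulrAC mulVf ?mul1r.
Qed.

Lemma restrict_rep n (U : 'M[C]_n) (A : G -> 'M[C]_n) : matrix_rep A ->
  (forall x, stablemx U (A x)) -> matrix_rep (fun x => restrictmx U (A x)).
Proof.
move=> rA sU; split=> [||x y].
- exact: (entries_continuousM (entries_continuousM (@entries_continuous_cst _ _ _)
    (rep_continuous rA)) (@entries_continuous_cst _ _ _)).
- by rewrite (rep0 rA) conjmx_scalar ?row_base_free.
- by rewrite (repD rA) conjmxM // inE stablemx_row_base.
Qed.

Lemma restrict_monomial_row n (U : 'M[C]_n) (A : G -> 'M[C]_n) d :
  (forall x, stablemx U (A x)) ->
  monomial_row (fun x => restrictmx U (A x)) d -> monomial_row A (d *m row_base U).
Proof.
move=> sU [m H]; exists m => v; have [D [pD DE]] := H (row_base U *m v).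
exists D; split=> // x; rewrite -DE /conjmx; congr (fun_of_matrix _ 0 0).
set Y := _ *m pinvmx _.
have YU : Y *m row_base U = row_base U *m A x by rewrite mulmxKpV ?stablemx_row_base.
by rewrite -(mulmxA d Y) (mulmxA Y) YU !mulmxA.
Qed.

Theorem monomial_rows_span n (A : G -> 'M[C]_n) (c : 'rV[C]_n) : matrix_rep A ->
  exists s : seq 'rV[C]_n, c = \sum_(d <- s) d /\ {in s, forall d, monomial_row A d}.
Proof.
elim/ltn_ind: n A c => n IH A c rA.
have [n0|n_gt0] := posnP n.
  by exists [::]; split=> //; subst n; rewrite big_nil thinmx0.
have [aA|] := pselect (forall x, exists a k, (A x - a%:M) ^+ k = 0).
  exists [:: c]; split=> [|d]; first by rewrite big_seq1.
  by rewrite inE => /eqP ->; exact: monomial_row_single.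
move=> /existsNP[x Ax].
have [a k|U [V [rU rV UV sUV]]] := @fitting_decomposition C n (A x).
  by apply/eqP => Ak; apply: Ax; exists a, k.
have sub (W : 'M[C]_n) (w : 'rV[C]_n) : (\rank W < n)%N -> (forall y, stablemx W (A y)) ->
    (w <= W)%MS -> exists s : seq 'rV[C]_n, w = \sum_(d <- s) d /\
    {in s, forall d, monomial_row A d}.
  move=> rW sW; rewrite -(eq_row_base W) => /submxP[d ->].
  have [s [-> sM]] := IH _ rW _ d (restrict_rep rA sW).
  exists [seq e *m row_base W | e <- s]; split; first by rewrite big_map mulmx_suml.
  by move=> _ /mapP[e es ->]; exact/restrict_monomial_row/sM.
have : (c <= U + V)%MS by rewrite UV submx1.
move=> /sub_addsmxP[[u v] /= ->].
have sU y : stablemx U (A y) by apply: (sUV _ _).1; exact: rep_comm.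
have sV y : stablemx V (A y) by apply: (sUV _ _).2; exact: rep_comm.
have [s [-> sM]] := sub U (u *m U) rU sU (submxMl _ _).
have [t [-> tM]] := sub V (v *m V) rV sV (submxMl _ _).
exists (s ++ t); split; first by rewrite big_cat.
by move=> d; rewrite mem_cat => /orP[/sM|/tM].
Qed.

Theorem finite_dimensional_variety_spanned (W : set E) (f : E) :
  is_subspace W -> (forall x g, W g -> W (cfun_translate x g)) ->
  finite_dimensional W -> W f ->
  exists s : seq E, f = \sum_(h <- s) h /\ {in s, forall h, W h /\
    exists (D : diff_operator R G) (m : exponential R G),
      polynomial_operator D /\ h = cfun_mul (generating_function D) (exponential_fun m)}.
Proof.
move=> sW tW fW Wf; have [r [g [lam [Wg lg Wlam]]]] := dual_basis sW fW.
pose A x : 'M[C]_r := \matrix_(i, j) lam j (cfun_translate x (g i)).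
have gA x i : cfun_translate x (g i) = \sum_j A x i j *: g j.
  rewrite [LHS]Wlam; last exact: tW.
  by apply: eq_bigr => j _; rewrite mxE.
have rA : matrix_rep A.
  split=> [i j||x y].
  - have := @cfun_continuous _ _ (partial_integral (lam j) (g i)).
    by apply: continuous_ext => x; rewrite mxE.
  - apply/matrixP => i j; rewrite !mxE.
    have -> : cfun_translate 0 (g i) = g i.
      by apply: cfunP => x; rewrite cfun_translateE add0r.
    by rewrite lg eq_sym.
  - apply/matrixP => i j; rewrite mxE.
    have -> : cfun_translate (x + y) (g i) = \sum_k A x i k *: cfun_translate y (g k).
      apply: cfunP => z.
      rewrite cfun_translateE -addrA -[LHS]/(cfun_translate x (g i) (y + z)) gA !cfun_sumE.
      by apply: eq_bigr => k _; rewrite !cfunZE.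
    rewrite linear_sum [RHS]mxE; apply: eq_bigr => k _.
    by rewrite linearZ; congr (_ * _); rewrite [RHS]mxE.
pose v : 'cV[C]_r := \col_i g i 0.
pose fc (c : 'rV[C]_r) : E := \sum_i c 0 i *: g i.
have fcE c x : fc c x = (c *m A x *m v) 0 0.
  rewrite cfun_sumE -mulmxA mxE; apply: eq_bigr => i _.
  rewrite cfunZE; congr (_ * _).
  rewrite -[x in LHS]addr0 -[LHS]/(cfun_translate x (g i) 0) gA cfun_sumE mxE.
  by apply: eq_bigr => j _; rewrite cfunZE !mxE.
have [s [sE sM]] := monomial_rows_span (\row_i lam i f) rA.
exists [seq fc d | d <- s]; split.
  rewrite big_map [LHS]Wlam // /fc exchange_big; apply: eq_bigr => i _ /=.
  have /(congr1 (fun M : 'rV[C]_r => M 0 i)) := sE.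
  by rewrite mxE summxE -scaler_suml => ->.
move=> _ /mapP[d ds ->]; split; first exact: subspace_sum.
have [m /(_ v)[D [pD DE]]] := sM d ds; exists D, m; split=> //.
by apply: cfunP => x; rewrite fcE DE.
Qed.

End matrix_representations.

(** * Annihilators and localization *)


Section localization_lemmas.
Context {R : realType} {G : topologicalZmodType}.
Local Notation C := (cplx R).
Local Notation E := (cfun R G).
Local Notation M := (cmeasure R G).
Implicit Types (mu nu : M) (f g : E) (m : exponential R G) (I : set M).

Lemma cfun_reflect_translateE x f y : cfun_reflect_translate x f y = f (x - y).
Proof. by []. Qed.

Lemma cfun_checkE f x : cfun_check f x = f (- x).
Proof. by []. Qed.

Lemma cfun_mulE f g x : cfun_mul f g x = f x * g x.
Proof. by []. Qed.

Lemma actE mu f x : act mu f x = mu (cfun_reflect_translate x f).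
Proof. by []. Qed.

Lemma act0E mu f : act mu f 0 = mu (cfun_check f).
Proof. by rewrite actE; congr (mu _); apply: cfunP => y; rewrite cfun_reflect_translateE sub0r. Qed.

Lemma act_linear mu : linear (act mu).
Proof.
move=> a f g; apply: cfunP => x; rewrite cfunDE cfunZE !actE -linearP.
by congr (mu _); exact: cfunP.
Qed.

Lemma act_translate mu f x : act mu (cfun_translate x f) = cfun_translate x (act mu f).
Proof.
apply: cfunP => y; rewrite cfun_translateE !actE; congr (mu _).
by apply: cfunP => z; rewrite !cfun_reflect_translateE cfun_translateE addrA.
Qed.

Lemma continuous_act mu x : continuous (fun f => act mu f x).
Proof.
have cx : continuous (fun y : G => x - y).
  by move=> y; exact: (cvg_comp2 (h := fun a b : G => a - b) (cvg_cst x) cvg_id (@sub_continuous G (x, y))).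
have -> : (fun f => act mu f x) = cmeasure_image cx mu.
  by apply/funext => f; rewrite actE; congr (mu _); exact: cfunP.
exact: cint_continuous.
Qed.

Lemma Ann_variety I : is_variety (Ann I).
Proof.
split=> [||x f If mu Imu].
- split=> [mu _|a f g If Ig mu Imu].
    by apply: cfunP => x; rewrite actE -[RHS](linear0 mu); congr (mu _); exact: cfunP.
  by rewrite act_linear If // Ig // scaler0 addr0.
- have -> : Ann I = \bigcap_(mu in I) \bigcap_(x in setT)
      ((fun f => act mu f x) @^-1` [set 0]).
    apply/seteqP; split=> [f If mu Imu x _|f If mu Imu].
      exact: (congr1 (fun h : E => h x) (If mu Imu)).
    by apply: cfunP => x; exact: If.
  apply: closed_bigI => mu _; apply: closed_bigI => x _.
  apply: preimage_closed; first by move=> f _; exact: continuous_act.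
  exact: (@accessible_closed_set1 C (hausdorff_accessible (@norm_hausdorff _ C))).
- rewrite act_translate If //; exact: cfunP.
Qed.

Lemma ideal_subspace I : is_ideal I -> is_cmeasure_subspace I.
Proof.
move=> [I0 ID IM]; split=> // c mu Imu.
have [+ _] := IM mu (cmeasure_scale c (dirac 0)) Imu.
congr I; apply: cmeasureP => f; rewrite cmeasure_scaleE /=; congr (_ * mu _).
by apply: cfunP => x; rewrite cfun_translateE add0r.
Qed.

Lemma Ann_checkP I f : is_ideal I ->
  (forall mu, I mu -> mu f = 0) -> Ann I (cfun_check f).
Proof.
move=> [_ _ IM] If mu Imu; apply: cfunP => x; rewrite actE cfun0E.
have [_ Imux] := IM mu (dirac (- x)) Imu; rewrite -(If _ Imux) /=.
by congr (mu _); apply: cfunP => y; rewrite cfun_reflect_translateE cfun_checkE opprB.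
Qed.

Lemma generalized_polynomial_translate f y :
  generalized_polynomial f -> generalized_polynomial (cfun_translate y f).
Proof.
move=> [n H]; exists n => ys.
have E (s : seq G) : foldr (fun z g => act (difference_measure z) g) (cfun_translate y f) s =
    cfun_translate y (foldr (fun z g => act (difference_measure z) g) f s).
  by elim: s => // z s IH; rewrite /= IH act_translate.
by rewrite E H; exact: cfunP.
Qed.

Lemma act_mul_exponential f m x mu :
  act mu (cfun_mul f m) x = exponential_fun m x * mu (cfun_mul (cfun_check (cfun_translate x f)) (cfun_check m)).
Proof.
rewrite actE -linearZ; congr (mu _); apply: cfunP => y.
rewrite cfunZE !(cfun_reflect_translateE, cfun_mulE, cfun_checkE, cfun_translateE).
by rewrite exponentialD mulrCA.
Qed.

Lemma diff_operatorE (D : diff_operator R G) mu m :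
  D (Fourier mu) m = mu (cfun_check (cfun_mul (generating_function D) m)).
Proof. by congr (mu _); exact: cfunP. Qed.

Lemma annihilatesP I m (D : diff_operator R G) :
  annihilates D (Fourier @` I) m <-> Ann I (cfun_mul (generating_function D) m).
Proof.
split=> [H mu Imu|H D' DD' _ [mu Imu <-]].
  apply: cfunP => x; rewrite act_mul_exponential.
  case: D H => p gp /= H.
  pose D' := DiffOperator (generalized_polynomial_translate x gp).
  have D'0 : D' (Fourier mu) m = 0.
    apply: H; last by exists mu.
    by move=> V [[_ _ tV] fV]; apply: tV; exact: fV.
  by rewrite [X in _ * X](_ : _ = D' (Fourier mu) m) // D'0 mulr0.
pose S : set E := [set f | Ann I (cfun_mul f m)].
have [[A0 AD] cA tA] := Ann_variety I.
have vS : is_variety S.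
  split=> [||x f Sf].
  - split; first by rewrite /S /= (_ : cfun_mul _ _ = 0) //; apply: cfunP => x; exact: mul0r.
    move=> a f g Sf Sg; rewrite /S /= (_ : cfun_mul _ _ = a *: cfun_mul f m + cfun_mul g m).
      exact: AD.
    by apply: cfunP => x; rewrite !(cfun_mulE, cfunDE, cfunZE) mulrDl mulrA.
  - by apply: (preimage_closed (f := fun f => cfun_mul f m)) => // f _; exact: continuous_cfun_mulr.
  - have mx0 : exponential_fun m x != 0 by exact: exponential_neq0.
    rewrite -[S _]/(Ann I (cfun_mul (cfun_translate x f) m)).
    rewrite (_ : cfun_mul _ _ = (exponential_fun m x)^-1 *: cfun_translate x (cfun_mul f m)).
      exact: (subspaceZ _ (conj A0 AD) (tA x _ Sf)).
    apply: cfunP => y.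
    by rewrite cfunZE !(cfun_mulE, cfun_translateE) exponentialD mulrCA mulKf.
have SD : [set generating_function D] `<=` S by move=> _ ->.
have /(_ mu Imu)/(congr1 (fun h : E => h 0)) := DD' S (conj vS SD).
by rewrite act0E -diff_operatorE.
Qed.

End localization_lemmas.

Theorem corollary2 (R : realType) (G : topologicalZmodType)
    (G_hausdorff : hausdorff_space G) (G_lc : locally_compact [set: G])
    (I : set (cmeasure R G)) (I_ideal : is_ideal I) (I_closed : closed I) :
  synthesizable (Ann I) <-> localizable (Fourier @` I).
Proof.
have sI := ideal_subspace I_ideal.
have vA := Ann_variety I; have [sA _ _] := vA.
pose FV := \bigcup_(W in [set W | [/\ is_variety W, finite_dimensional W &
  W `<=` Ann I]]) W.
split=> [syn [nu] H|loc f Af].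
  exists nu => //; apply: (bipolar sI I_closed) => f /(Ann_checkP I_ideal) /syn.
  pose N : set (cfun R G) := [set g | act nu g 0 = 0].
  have cN : closed N.
    apply: (preimage_closed (f := fun g => act nu g 0) (D := [set 0])).
      by move=> g _; exact: continuous_act.
    exact: (@accessible_closed_set1 _ (hausdorff_accessible (@norm_hausdorff _ (cplx R)))).
  have sN : is_subspace N.
    split=> [|a g h Ng Nh].
      by rewrite -[N 0]/(act nu 0 0 = 0) act0E -[RHS](linear0 nu); congr (nu _); exact: cfunP.
    rewrite -[N _]/(act nu (a *: g + h) 0 = 0) act_linear cfunDE cfunZE.
    by rewrite (Ng : act nu g 0 = 0) (Nh : act nu h 0 = 0) mulr0 addr0.
  have FN : FV `<=` N.
    move=> g [W [[sW _ tW] fW WA] Wg].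
    have [s [-> sM]] := finite_dimensional_variety_spanned sW tW fW Wg.
    rewrite big_seq; apply: (big_ind N) => [|a b|h /sM]; first exact: sN.1.
      exact: subspaceD.
    move=> [Wh [D [m [pD hE]]]]; rewrite -[N h]/(act nu h 0 = 0) act0E hE -diff_operatorE; apply: H.
    by split=> //; apply/annihilatesP; rewrite -hE; exact: WA.
  move=> cf; have : N (cfun_check f).
    apply: cN; apply: closureS cf => g; apply; split=> //.
  rewrite -[N _]/(act nu (cfun_check f) 0 = 0) act0E; congr (nu _ = 0).
  by apply: cfunP => x; rewrite !cfun_checkE opprK.
apply: contrapT => ncl.
have sFV : is_subspace (lin_span FV).
  split=> [V [[V0 _] _] //|a g h Lg Lh V VF].
  exact: (VF.1.2 a g h (Lg V VF) (Lh V VF)).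
have [la [laFV laf]] := closure_separation sFV ncl.
pose nu := cmeasure_image (@opp_continuous G) la.
have laE g : la g = nu (cfun_check g).
  by congr (la _); apply: cfunP => x; rewrite -[RHS]/(cfun_check g (- x)) cfun_checkE opprK.
have [] := loc (Fourier nu).
  move=> m D [pD /annihilatesP AD].
  rewrite diff_operatorE -laE.
  apply: laFV => V [sV]; apply.
  have [|W [vW fW WA Wp]] := finite_orbit_variety vA AD _.
    apply: finite_orbitM; first exact: finite_orbit_polynomial.
    exact: finite_orbit_exponential.
  by exists W.
move=> nu' Inu [nuE]; case/eqP: laf; rewrite laE -nuE -act0E.
by rewrite Af.
Qed.
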